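(* Let $m\ge1$ and let $L_i(z)=\sum_{j=1}^m a_{ij}z_j+b_i=\mathbf{a}_i\cdot z+b_i$, $i=1,\dotsc,d$, be affine functions on $\mathbb{C}^m$ with $|\mathbf{a}_i|=1$, whose zero sets $W_i=\{L_i=0\}$ form a generic hyperplane arrangement (in particular the $W_i$ are distinct and $W_i\cap W_j\ne\emptyset$ for all $i,j$). Let $P=L_1\cdots L_d$, $$\Psi(z)=\max_{i=1,\dotsc,d}\log|L_i(z)|^{-1}+\log|P(z)|\;\Big(=\max_i\sum_{j\ne i}\log|L_j(z)|\Big),$$ $E=dd^c\Psi$, and $E_n=dd^c\log\big|P^n(L_1^{-n}+\dots+L_d^{-n})\big|$, where $P^n(L_1^{-n}+\dots+L_d^{-n})=\sum_{i}\prod_{j\ne i}L_j^n$ is a polynomial. Then $\frac1nE_n\to E$ as currents (weakly, i.e. when paired with any smooth compactly supported test form of bidegree $(m-1,m-1)$).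
   Context: $|\mathbf{a}_i|$ is the Hermitian norm of $\mathbf{a}_i=(a_{i1},\dotsc,a_{im})\in\mathbb{C}^m$ (so $|L_i(z)|$ is the distance from $z$ to $W_i$). $d^c$ is the standard real operator with $dd^c=\frac{i}{\pi}\partial\bar\partial$, and $dd^c$ of a plurisubharmonic (or locally integrable) function is taken in the sense of currents; $E_n$ is, up to normalization, the current of integration over the hypersurface $\{\sum_i\prod_{j\neq i}L_j^n=0\}$ with multiplicities, and $E$ is supported on the codimension-one skeleton of the Voronoi stratification $\{z:|L_i(z)|=\min_k|L_k(z)|\}$. *)

(* Defs.v *)
From mathcomp Require Import all_boot all_order all_algebra.
From mathcomp Require Import all_classical all_reals all_analysis.
From mathcomp Require Import complex.
Set Implicit Arguments. Unset Strict Implicit. Unset Printing Implicit Defensive.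
Import Order.TTheory GRing.Theory Num.Theory.
Import numFieldNormedType.Exports.
Local Open Scope ring_scope.
Local Open Scope complex_scope.
Local Open Scope classical_set_scope.

(** Points of C^m are encoded as real row vectors p of length m + m:
    z_j = p_(j) + i p_(m+j)  (real coordinates x_j = p 0 (lshift m j),
    y_j = p 0 (rshift m j)). *)
Definition cpt (R : realType) (m : nat) (p : 'rV[R]_(m + m)) : 'I_m -> R[i] :=
  fun j => (p 0 (lshift m j)) +i* (p 0 (rshift m j)).

Definition cabs (R : realType) (w : R[i]) : R := @Normc.normc R w.

Definition affL (R : realType) (d m : nat) (a : 'I_d -> 'I_m -> R[i])
  (b : 'I_d -> R[i]) (i : 'I_d) (z : 'I_m -> R[i]) : R[i] :=
  \sum_(j < m) a i j * z j + b i.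

Definition generic_arrangement (R : realType) (d m : nat)
  (a : 'I_d -> 'I_m -> R[i]) (b : 'I_d -> R[i]) : Prop :=
  forall S : {set 'I_d},
    ((#|S| <= m)%N ->
       forall c : 'I_d -> R[i],
         (forall j : 'I_m, \sum_(i in S) c i * a i j = 0) ->
         forall i, i \in S -> c i = 0)
    /\ ((m < #|S|)%N ->
       ~ (exists z : 'I_m -> R[i], forall i, i \in S -> affL a b i z = 0)).

(** The polynomial P^n (L_1^-n + ... + L_d^-n) = sum_i prod_(j != i) L_j^n. *)
Definition Qpoly (R : realType) (d m : nat) (a : 'I_d -> 'I_m -> R[i])
  (b : 'I_d -> R[i]) (n : nat) (z : 'I_m -> R[i]) : R[i] :=
  \sum_(i < d) \prod_(j < d | j != i) (affL a b j z) ^+ n.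

(** Psi(z) = max_i sum_(j != i) log |L_j(z)|  (the max is taken in \bar R
    with bottom -oo and is finite as soon as d >= 1). *)
Definition Psi (R : realType) (d m : nat) (a : 'I_d -> 'I_m -> R[i])
  (b : 'I_d -> R[i]) (z : 'I_m -> R[i]) : R :=
  fine (\big[Order.max/-oo%E]_(i < d)
          (\sum_(j < d | j != i) ln (cabs (affL a b j z)))%:E).

Definition rpartial (R : realType) (N : nat) (k : 'I_N) (f : 'rV[R]_N -> R)
  : 'rV[R]_N -> R :=
  fun p => derive f p (delta_mx 0 k).

Definition iter_partial (R : realType) (N : nat) (ks : seq 'I_N)
  (f : 'rV[R]_N -> R) : 'rV[R]_N -> R :=
  foldr (@rpartial R N) f ks.

Definition smooth (R : realType) (N : nat) (f : 'rV[R]_N -> R) : Prop :=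
  forall ks : seq 'I_N,
    continuous (iter_partial ks f) /\
    (forall (k : 'I_N) (p : 'rV[R]_N), derivable (iter_partial ks f) p (delta_mx 0 k)).

Definition compact_support (R : realType) (N : nat) (f : 'rV[R]_N -> R) : Prop :=
  exists M : R, forall p : 'rV[R]_N, M < `|p| -> f p = 0.

(** Lebesgue integral over R^N, written as the iterated one-dimensional
    Lebesgue integral (equal to the N-dimensional integral for the L^1
    integrands considered here, by Fubini). *)
Fixpoint iint (R : realType) (N : nat) : ('rV[R]_N -> R) -> R :=
  match N return ('rV[R]_N -> R) -> R with
  | 0 => fun f => f 0
  | N'.+1 => fun f =>
      Rintegral (@lebesgue_measure R) setT
        (fun x : R => iint (fun v : 'rV[R]_N' => f (row_mx (const_mx x : 'rV[R]_1) v)))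
  end.

(** Coefficient operators of dd^c in real coordinates:
    4 d^2/(dz_j dzbar_k) = (dx_j dx_k + dy_j dy_k) + i (dx_j dy_k - dy_j dx_k). *)
Definition ddc_re (R : realType) (m : nat) (j k : 'I_m) (f : 'rV[R]_(m + m) -> R)
  : 'rV[R]_(m + m) -> R :=
  fun p => rpartial (lshift m j) (rpartial (lshift m k) f) p
         + rpartial (rshift m j) (rpartial (rshift m k) f) p.

Definition ddc_im (R : realType) (m : nat) (j k : 'I_m) (f : 'rV[R]_(m + m) -> R)
  : 'rV[R]_(m + m) -> R :=
  fun p => rpartial (lshift m j) (rpartial (rshift m k) f) p
         - rpartial (rshift m j) (rpartial (lshift m k) f) p.

(** Weak convergence of the currents dd^c u_n -> dd^c v on C^m (u_n, v locally
    integrable real functions): every coefficient distribution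
    d^2 u_n/(dz_j dzbar_k) converges to d^2 v/(dz_j dzbar_k), i.e. for every
    smooth compactly supported test function chi,
    int u_n d^2chi/(dz_j dzbar_k) -> int v d^2chi/(dz_j dzbar_k)
    (real and imaginary parts). This is the pairing with all test forms of
    bidegree (m-1,m-1), written out coefficientwise. *)
Definition ddc_cvg (R : realType) (m : nat) (u : nat -> 'rV[R]_(m + m) -> R)
  (v : 'rV[R]_(m + m) -> R) : Prop :=
  forall chi : 'rV[R]_(m + m) -> R, smooth chi -> compact_support chi ->
  forall j k : 'I_m,
    ((fun n => iint (fun p => u n p * ddc_re j k chi p)) @ \oo
       --> iint (fun p => v p * ddc_re j k chi p))
    /\
    ((fun n => iint (fun p => u n p * ddc_im j k chi p)) @ \oo
       --> iint (fun p => v p * ddc_im j k chi p)).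

(* Main.v *)
Require Import Defs.
From mathcomp Require Import all_boot all_order all_algebra.
From mathcomp Require Import all_classical all_reals all_analysis.
From mathcomp Require Import measurable_realfun complex ring lra zify.

(** A second derivative of a test function is continuous with compact support, so it is
    enough that u_n = (1/n) log |Q_n| tends to Psi in L^1 on every box.  Where the minimum
    of the |L_i| is nonzero and attained only once, one term dominates the sum Q_n and
    u_n -> Psi; genericity makes the exceptional set a finite union of zero sets of
    nonzero real polynomials.  Pointwise convergence becomes L^1 convergence by a bound in
    L^2 that is uniform in n: a polynomial of degree D in one variable splits into linear
    factors, whence log (|P(x0)| / |P(x)|) <= sum_rho log (1 + |x - x0| / |x - rho|), and
    the L^2 norm of the right-hand side on an interval is at most a constant times D.
    One coordinate at a time, this controls log (|Q_n(p0)| / |Q_n(p)|), where Q_n has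
    degree O(n), by a constant times n, at a fixed point p0 where u_n(p0) converges. *)

Set Implicit Arguments. Unset Strict Implicit. Unset Printing Implicit Defensive.
Import Order.TTheory GRing.Theory Num.Theory.
Import numFieldNormedType.Exports.
Local Open Scope ring_scope.
Local Open Scope classical_set_scope.

(** * Iterated integrals over a box *)

(** The integral of the statement is iterated, coordinate by coordinate, and a divergent inner
    integral silently gets the value 0. Measurability, null sets and L^1 bounds are therefore
    defined by the same recursion on the dimension, and no measure on R^N appears. This fits the
    estimate: a polynomial restricted to a line is a polynomial in one variable of no larger degree.
    The obstacle is that u_n is very negative close to the zero set of Q_n, and this set moves with
    n, so no majorant common to all n is at hand for dominated convergence; the L^2 bound gives
    uniform integrability instead. Only the drop below the value at p0 has to be estimated, since
    the size of Q_n on a box bounds u_n from above. For the drop, Cauchy-Schwarz over the at most D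
    roots costs one factor D and the sum over the roots another; as D = O(n), the resulting D^2 is
    absorbed by the factor n^-2 in u_n^2. The size of the coefficients of Q_n never enters, because
    the leading one cancels in the quotient. *)

Definition consrv (R : realType) (N : nat) (x : R) (v : 'rV[R]_N) : 'rV[R]_N.+1 :=
  row_mx (const_mx x : 'rV[R]_1) v.

(* [measN f] says that [f], seen as a function on [X * R * ... * R] with [N] factors
   [R], is measurable; the parameter space [X] is what makes recursion on [N] work. *)
Fixpoint measN (R : realType) (N : nat) :
    forall (d : measure_display) (X : measurableType d) (d' : measure_display)
      (Y : measurableType d'), (X -> 'rV[R]_N -> Y) -> Prop :=
  match N return forall (d : measure_display) (X : measurableType d) (d' : measure_display)
      (Y : measurableType d'), (X -> 'rV[R]_N -> Y) -> Prop with
  | 0 => fun d X d' Y f => measurable_fun [set: X] (fun x => f x 0)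
  | N'.+1 => fun d X d' Y f =>
      measN (fun (xr : X * R) (v : 'rV[R]_N') => f xr.1 (consrv xr.2 v))
  end.

Definition symitv (R : realType) (M : R) : set R := `[- M, M]%classic.

Lemma measurable_symitv (R : realType) (M : R) : measurable (symitv M).
Proof. exact: measurable_itv. Qed.

(* The domain of [lebesgue_measure] is [measurableTypeR R]; its sigma-algebra is
   the one of [R] only up to conversion, which hints do not see through. *)
Lemma measurable_symitv_lebesgue (R : realType) (M : R) :
  measurable (symitv M : set (measurableTypeR R)).
Proof. exact: measurable_symitv. Qed.

#[local] Hint Resolve measurable_symitv measurable_symitv_lebesgue : core.

(** Values in [\bar R], so that for nonnegative integrands monotonicity and additivity are available
    before any finiteness is known. *)
Fixpoint boxint (R : realType) (M : R) (N : nat) : ('rV[R]_N -> \bar R) -> \bar R :=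
  match N return ('rV[R]_N -> \bar R) -> \bar R with
  | 0 => fun f => f 0
  | N'.+1 => fun f =>
      (\int[@lebesgue_measure R]_(x in symitv M) boxint M (fun v => f (consrv x v)))%E
  end.

(* For almost every [x_1], for almost every [x_2], ...: the notion of null set that
   iterated integrals do not see. *)
Fixpoint aeN (R : realType) (N : nat) : ('rV[R]_N -> Prop) -> Prop :=
  match N return ('rV[R]_N -> Prop) -> Prop with
  | 0 => fun P => P 0
  | N'.+1 => fun P =>
      {ae @lebesgue_measure R, forall x : R, aeN (fun v => P (consrv x v))}
  end.

(** * Measurability in a parameter and N real coordinates *)

Section Measurability.
Context (R : realType).
Implicit Types (N : nat) (d : measure_display).

Lemma measN_comp N d (X : measurableType d) d' (Y : measurableType d')
    d'' (Z : measurableType d'') (g : Y -> Z) (f : X -> 'rV[R]_N -> Y) :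
  measurable_fun [set: Y] g -> measN f -> measN (fun x v => g (f x v)).
Proof.
move=> mg; elim: N d X f => [|N IH] d X f /= mf; last exact: (IH _ _ _ mf).
exact: (measurableT_comp mg mf).
Qed.

Lemma measN_pair N d (X : measurableType d) d' (Y : measurableType d')
    d'' (Z : measurableType d'') (f : X -> 'rV[R]_N -> Y) (g : X -> 'rV[R]_N -> Z) :
  measN f -> measN g -> measN (fun x v => (f x v, g x v)).
Proof.
elim: N d X f g => [|N IH] d X f g /= mf mg; last exact: (IH _ _ _ _ mf mg).
exact: measurable_fun_pair.
Qed.

Lemma measN_subst N d (X : measurableType d) d' (Y : measurableType d')
    d'' (Z : measurableType d'') (h : Z -> X) (f : X -> 'rV[R]_N -> Y) :
  measurable_fun [set: Z] h -> measN f -> measN (fun z v => f (h z) v).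
Proof.
elim: N d X d'' Z h f => [|N IH] d X d'' Z h f /= mh mf.
  exact: (measurableT_comp mf mh).
apply: (IH _ _ _ _ (fun zr : Z * R => (h zr.1, zr.2)) _ _ mf).
apply: measurable_fun_pair => //.
exact: measurableT_comp.
Qed.

Lemma boxint_ge0 (M : R) N (f : 'rV[R]_N -> \bar R) :
  (forall v, (0 <= f v)%E) -> (0 <= boxint M f)%E.
Proof.
elim: N f => [|N IH] f f0 /=; first exact: f0.
by apply: integral_ge0 => x _; exact: IH.
Qed.

Lemma measurable_boxint (M : R) N d (X : measurableType d) (f : X -> 'rV[R]_N -> \bar R) :
  (forall x v, (0 <= f x v)%E) -> measN f ->
  measurable_fun [set: X] (fun x => boxint M (f x)).
Proof.
elim: N d X f => [|N IH] d X f f0 /= mf; first exact: mf.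
pose g (xr : X * R) := boxint M (fun v => f xr.1 (consrv xr.2 v)).
have mg : measurable_fun setT g by apply: (IH _ _ _ _ mf).
(* [fubini_F] integrates over the whole line; the indicator cuts out the interval. *)
pose h (xr : X * R) := (g xr * (\1_(symitv M) xr.2)%:E)%E.
have mh : measurable_fun setT h.
  apply: emeasurable_funM => //; apply/measurable_EFinP.
  apply: (measurableT_comp _ measurable_snd); apply: measurable_indic.
  exact: measurable_symitv.
have h0 xr : (0 <= h xr)%E.
  by rewrite mule_ge0 ?lee_fin //; apply: boxint_ge0.
rewrite (_ : (fun x => _) = fubini_F (@lebesgue_measure R) h).
  exact: measurable_fun_fubini_tonelli_F.
apply/funext => x; rewrite /fubini_F [LHS]integral_mkcond epatch_indic.
by apply: eq_integral => r _.
Qed.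

(** Tonelli handles nonnegative functions only, so the positive and negative parts are integrated
    separately. Subtraction on [\bar R] and [fine] are measurable, so divergent slices cause no
    trouble. *)
Lemma measurable_iint N d (X : measurableType d) (f : X -> 'rV[R]_N -> R) :
  measN f -> measurable_fun [set: X] (fun x => iint (f x)).
Proof.
elim: N d X f => [|N IH] d X f /= mf; first exact: mf.
pose g (xr : X * R) := iint (fun v => f xr.1 (consrv xr.2 v)).
have mg : measurable_fun setT g by exact: (IH _ _ _ mf).
have mG : measurable_fun setT (EFin \o g) by exact/measurable_EFinP.
rewrite (_ : (fun x => _) = fun x => fine
    (fubini_F (@lebesgue_measure R) ((EFin \o g)^\+)%E x
     - fubini_F (@lebesgue_measure R) ((EFin \o g)^\-)%E x)).
  apply: measurableT_comp => //.
  apply: emeasurable_funB; apply: measurable_fun_fubini_tonelli_F => //.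
  exact: measurable_funepos.
  exact: measurable_funeneg.
apply/funext => x; rewrite /Rintegral; congr fine; rewrite integralE.
by congr (_ - _)%E; rewrite /fubini_F; apply: eq_integral => r _; rewrite ?funeposE ?funenegE.
Qed.

Definition rfloor (k : nat) (r : R) : R := (Num.floor (k.+1%:R * r))%:~R / k.+1%:R.

(* A function measurable in [x] and continuous in [r] is the limit of the
   [f x (rfloor k r)], whose joint measurability is a countable union. *)
Lemma measurable_caratheodory d (X : measurableType d) (f : X -> R -> R) :
  (forall r, measurable_fun setT (f^~ r)) -> (forall x, continuous (f x)) ->
  measurable_fun [set: X * R] (fun xr => f xr.1 xr.2).
Proof.
move=> mf cf.
apply: (@measurable_fun_cvg _ (X * R)%type R setT
  (fun k (xr : X * R) => f xr.1 (rfloor k xr.2))) => //.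
  move=> k _ B mB; rewrite setTI.
  rewrite (_ : _ @^-1` B = \bigcup_(z : int)
     ((fst @^-1` ((f^~ (z%:~R / k.+1%:R)) @^-1` B)) `&`
      (snd @^-1` [set r : R | (z%:~R <= k.+1%:R * r) && (k.+1%:R * r < (z + 1)%:~R)]))); last first.
    apply/seteqP; split => [[x r] /= Bx|[x r] /= [z _ [/= Bx zr]]].
      by exists (Num.floor (k.+1%:R * r)) => //; split => //=; exact: floor_itv.
    by rewrite /rfloor (floor_def zr).
  apply: countable_bigcupT_measurable; first exact: countableP.
  move=> z; apply: measurableI.
    rewrite -[X in measurable X]setTI; apply: measurable_fst => //.
    by rewrite -[X in measurable X]setTI; apply: mf.
  rewrite -[X in measurable X]setTI; apply: measurable_snd => //.
  have E (r : R) : (r \in `[z%:~R / k.+1%:R, (z + 1)%:~R / k.+1%:R[%R) =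
      (z%:~R <= k.+1%:R * r) && (k.+1%:R * r < (z + 1)%:~R).
    by rewrite in_itv /= ler_pdivrMr // ltr_pdivlMr // (mulrC r).
  rewrite (_ : [set r : R | _] = [set` `[z%:~R / k.+1%:R, (z + 1)%:~R / k.+1%:R[%R]); last first.
    by apply/seteqP; split => r /=; rewrite -E.
  exact: measurable_itv.
move=> [x r] _ /=.
apply: (@cvg_comp _ _ _ (fun k => rfloor k r) (f x)); last exact: cf.
apply/cvgrPdist_le => e e0.
have /cvgrPdist_le/(_ e e0) := @cvg_harmonic R.
apply: filterS => k; rewrite sub0r normrN /harmonic => He.
apply: le_trans He; rewrite [leRHS]ger0_norm ?invr_ge0 //.
have /andP[h1 h2] := floor_itv (k.+1%:R * r).
have k0 : 0 < k.+1%:R :> R by [].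
rewrite /rfloor ger0_norm; last by rewrite subr_ge0 ler_pdivrMr // [r * _]mulrC.
rewrite -(ler_pM2r k0) mulrBl divfK ?gt_eqF // mulVf ?gt_eqF //.
by rewrite lerBlDr (mulrC r) addrC; move: h2; rewrite intrD => /ltW.
Qed.

Lemma normrv_le N (p : 'rV[R]_N) (e : R) : 0 <= e ->
  (`|p| <= e) <-> (forall i, `|p 0 i| <= e).
Proof.
move=> e0; rewrite /Num.norm /= mx_normrE; split => [h i|h].
  by apply: le_trans h; apply: (le_bigmax _ (fun ij => `|p ij.1 ij.2|) (0, i)).
by apply: bigmax_le => // -[a i] _ /=; have := h i; rewrite (ord1 a).
Qed.

Lemma consrv_l N (x : R) (v : 'rV[R]_N) : consrv x v 0 (lshift N (0 : 'I_1)) = x.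
Proof. by rewrite /consrv (@row_mxEl _ 1 1 N) mxE. Qed.

Lemma consrv_r N (x : R) (v : 'rV[R]_N) j : consrv x v 0 (rshift 1 j) = v 0 j.
Proof. by rewrite /consrv (@row_mxEr _ 1 1 N). Qed.

Lemma consrv_eqP N (p q : 'rV[R]_N.+1) :
  p 0 (lshift N (0 : 'I_1)) = q 0 (lshift N (0 : 'I_1)) ->
  (forall j, p 0 (rshift 1 j) = q 0 (rshift 1 j)) -> p = q.
Proof.
move=> h0 h; apply/rowP => i; case: (@split_ordP 1 N i) => j -> //.
by rewrite (ord1 j).
Qed.

Lemma norm_consrv_le N (x : R) (v : 'rV[R]_N) (e : R) : 0 <= e ->
  (`|consrv x v| <= e) <-> (`|x| <= e /\ `|v| <= e).
Proof.
move=> e0; rewrite !normrv_le //; split.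
  move=> h; split; first by have := h (lshift N (0 : 'I_1)); rewrite consrv_l.
  by move=> i; have := h (rshift 1 i); rewrite consrv_r.
move=> [hx hv] i; case: (@split_ordP 1 N i) => j ->; last by rewrite consrv_r.
by rewrite (ord1 j) consrv_l.
Qed.

Lemma consrvD N (x y : R) (v w : 'rV[R]_N) :
  consrv x v + consrv y w = consrv (x + y) (v + w).
Proof.
by apply: consrv_eqP => [|j]; rewrite mxE ?consrv_l // !consrv_r mxE.
Qed.

Lemma consrvZ N (t x : R) (v : 'rV[R]_N) : t *: consrv x v = consrv (t * x) (t *: v).
Proof.
by apply: consrv_eqP => [|j]; rewrite mxE ?consrv_l // !consrv_r mxE.
Qed.

Lemma consrvB N (x y : R) (v w : 'rV[R]_N) :
  consrv x v - consrv y w = consrv (x - y) (v - w).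
Proof. by rewrite -scaleN1r consrvZ consrvD scaleN1r mulN1r. Qed.

Lemma continuous_consrv N (v : 'rV[R]_N) : continuous (fun r : R => consrv r v).
Proof.
move=> r; apply/cvgrPdist_le => e e0.
have : nbhs r (ball r e) by exact: nbhsx_ballx.
apply: filterS => t; rewrite -ball_normE /= => /ltW rt; rewrite consrvB.
apply/norm_consrv_le; rewrite ?subrr ?normr0; first exact: ltW.
by split => //; exact: ltW.
Qed.

Lemma continuous_consrvr N (r : R) : continuous (@consrv R N r).
Proof.
move=> v; apply/(@cvgrPdist_le _ _ _ (nbhs v) _ (@consrv R N r)) => e e0.
have : nbhs v (ball v e) by exact: nbhsx_ballx.
apply: filterS => t; rewrite -ball_normE /= => /ltW rt; rewrite consrvB.
apply/norm_consrv_le; rewrite ?subrr ?normr0; first exact: ltW.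
by split => //; exact: ltW.
Qed.

(** Coordinates move one at a time into the parameter space: continuity in the first coordinate
    gives measurability in the pair of parameter and coordinate, by [measurable_caratheodory], while
    continuity in the remaining ones is kept. *)
Lemma measN_caratheodory N d (X : measurableType d) (f : X -> 'rV[R]_N -> R) :
  (forall v, measurable_fun setT (f^~ v)) -> (forall x, continuous (f x)) -> measN f.
Proof.
elim: N d X f => [|N IH] d X f mf cf /=; first exact: mf.
apply: IH => [v|[x r] /=].
  apply: (@measurable_caratheodory _ _ (fun x r => f x (consrv r v))) => // x r.
  apply: (@continuous_comp _ _ _ (fun r => consrv r v) (f x)); last exact: cf.
  exact: continuous_consrv.
move=> v; apply: (@continuous_comp _ _ _ (consrv r) (f x)); last exact: cf.
exact: continuous_consrvr.
Qed.
End Measurability.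

Definition measR (R : realType) (N : nat) (d : measure_display) (Y : measurableType d)
  (f : 'rV[R]_N -> Y) : Prop := measN (fun _ : unit => f).

(** * Iterated almost-everywhere statements *)

Section AlmostEverywhere.
Context (R : realType).
Implicit Types (N : nat).

Lemma aelebS (P Q : R -> Prop) : (forall x, P x -> Q x) ->
  {ae @lebesgue_measure R, forall x, P x} -> {ae @lebesgue_measure R, forall x, Q x}.
Proof. exact: (@filterS _ _ (ae_filter_ringOfSetsType (@lebesgue_measure R))). Qed.

Lemma aelebS2 (P Q S : R -> Prop) : (forall x, P x -> Q x -> S x) ->
  {ae @lebesgue_measure R, forall x, P x} -> {ae @lebesgue_measure R, forall x, Q x} ->
  {ae @lebesgue_measure R, forall x, S x}.
Proof. exact: (@filterS2 _ _ (ae_filter_ringOfSetsType (@lebesgue_measure R))). Qed.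

Lemma aeN_all N (P : 'rV[R]_N -> Prop) : (forall p, P p) -> aeN P.
Proof.
elim: N P => [|N IH] P h /=; first exact: h.
by apply: aeW => x; apply: IH.
Qed.

Lemma aeN_imply N (P Q : 'rV[R]_N -> Prop) :
  (forall p, P p -> Q p) -> aeN P -> aeN Q.
Proof.
elim: N P Q => [|N IH] P Q h /=; first exact: h.
by apply: aelebS => x; apply: IH => v; exact: h.
Qed.

Lemma aeN_and N (P Q : 'rV[R]_N -> Prop) :
  aeN P -> aeN Q -> aeN (fun p => P p /\ Q p).
Proof.
elim: N P Q => [|N IH] P Q /=; first by [].
by apply: aelebS2 => x; exact: IH.
Qed.

Lemma aeN_forall N (I : finType) (P : I -> 'rV[R]_N -> Prop) :
  (forall i, aeN (P i)) -> aeN (fun p => forall i, P i p).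
Proof.
move=> h; suff : aeN (fun p => forall i, i \in enum I -> P i p).
  by apply: aeN_imply => p hp i; apply: hp; rewrite mem_enum.
elim: (enum I) => [|i s IH]; first exact: aeN_all.
apply: aeN_imply (aeN_and (h i) IH) => p [Pi Ps] j.
by rewrite inE => /orP[/eqP ->//|]; exact: Ps.
Qed.

Lemma ae_lebesgue_ex (P : R -> Prop) :
  {ae @lebesgue_measure R, forall x, P x} -> exists x, P x.
Proof.
move=> [A [mA A0 hA]]; apply: contrapT => /forallNP h.
have AT : A = setT by apply/seteqP; split => // x _; apply: hA; exact: h.
have h1 : (@lebesgue_measure R (symitv 1) <= @lebesgue_measure R setT)%E.
  by apply: le_measure => //; rewrite inE //; exact: measurable_symitv.
move: h1; rewrite -AT A0 /symitv lebesgue_measure_itv /= lte_fin gtrN ?ltr01 // -EFinB lee_fin.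
by rewrite opprK => h1; have := ltr01 (R := R); lra.
Qed.

(** Turns a null-set statement into an actual base point for the logarithmic estimates. *)
Lemma aeN_ex N (P : 'rV[R]_N -> Prop) : aeN P -> exists p, P p.
Proof.
elim: N P => [|N IH] P /=; first by exists 0.
by move=> /ae_lebesgue_ex[x /IH[v Pv]]; exists (consrv x v).
Qed.
End AlmostEverywhere.

(** * Integrals over cubes and their comparison with [iint] *)

Section BoxIntegral.
Context (R : realType) (M : R) (M0 : 0 <= M).
Implicit Types (N : nat).

Lemma measR_slice N d (Y : measurableType d) (f : 'rV[R]_N.+1 -> Y) (x : R) :
  measR f -> measR (fun v => f (consrv x v)).
Proof.
move=> mf; apply: (@measN_subst _ _ _ _ _ _ _ _ (fun _ : unit => (tt, x)) _ _ mf).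
exact: measurable_cst.
Qed.

Lemma measN_slice N d (Y : measurableType d) (f : 'rV[R]_N.+1 -> Y) :
  measR f -> measN (fun (x : R) v => f (consrv x v)).
Proof.
move=> mf; apply: (@measN_subst _ _ _ _ _ _ _ _ (fun x : R => (tt, x)) _ _ mf).
by apply: measurable_fun_pair => //; exact: measurable_cst.
Qed.

Lemma measR_comp N d (Y : measurableType d) d' (Z : measurableType d')
    (g : Y -> Z) (f : 'rV[R]_N -> Y) :
  measurable_fun setT g -> measR f -> measR (fun p => g (f p)).
Proof. by move=> mg mf; exact: (measN_comp mg mf). Qed.

Lemma measR_comp2 N d (Y : measurableType d) d' (Z : measurableType d')
    d'' (W : measurableType d'') (g : Y -> Z -> W) (f1 : 'rV[R]_N -> Y) (f2 : 'rV[R]_N -> Z) :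
  measurable_fun setT (fun yz => g yz.1 yz.2) -> measR f1 -> measR f2 ->
  measR (fun p => g (f1 p) (f2 p)).
Proof. by move=> mg m1 m2; exact: (measN_comp mg (measN_pair m1 m2)). Qed.

Lemma measR_fun1 N (g : R -> R) (f : 'rV[R]_N -> R) :
  measurable_fun setT g -> measR f -> measR (fun p => g (f p)).
Proof. exact: measR_comp. Qed.

Lemma measR_fun2 N (g : R -> R -> R) (f1 f2 : 'rV[R]_N -> R) :
  measurable_fun setT (fun yz : R * R => g yz.1 yz.2) -> measR f1 -> measR f2 ->
  measR (fun p => g (f1 p) (f2 p)).
Proof. exact: measR_comp2. Qed.

Lemma measR_cst N d (Y : measurableType d) (y : Y) : measR (fun _ : 'rV[R]_N => y).
Proof.
suff : forall d' (X : measurableType d'), measN (fun (_ : X) (_ : 'rV[R]_N) => y) by exact.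
elim: N => [|N IH] d' X /=; last exact: IH.
exact: measurable_cst.
Qed.

Lemma measurable_slice_boxint N (f : 'rV[R]_N.+1 -> \bar R) :
  (forall p, (0 <= f p)%E) -> measR f ->
  measurable_fun (symitv M) (fun x => boxint M (fun v => f (consrv x v))).
Proof.
move=> f0 mf; apply: measurable_funTS.
by apply: measurable_boxint => //; exact: measN_slice.
Qed.

Lemma le_boxint_ae N (f g : 'rV[R]_N -> \bar R) :
  (forall p, (0 <= f p)%E) -> (forall p, (0 <= g p)%E) -> measR f -> measR g ->
  aeN (fun p => `|p| <= M -> (f p <= g p)%E) -> (boxint M f <= boxint M g)%E.
Proof.
elim: N f g => [|N IH] f g f0 g0 mf mg /= h.
  by apply: h; apply/normrv_le => // -[].
apply: ae_ge0_le_integral => //; try exact: measurable_slice_boxint.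
- exact: measurable_symitv.
- by move=> x _; exact: boxint_ge0.
- by move=> x _; exact: boxint_ge0.
- apply: aelebS h => x hx Mx; apply: IH => //; try exact: measR_slice.
  apply: aeN_imply hx => v hv vM; apply: hv; apply/norm_consrv_le => //; split => //.
  by rewrite ler_norml; move: Mx; rewrite /symitv /= in_itv.
Qed.

Lemma le_boxint N (f g : 'rV[R]_N -> \bar R) :
  (forall p, (0 <= f p)%E) -> measR f -> measR g ->
  (forall p, (f p <= g p)%E) -> (boxint M f <= boxint M g)%E.
Proof.
move=> f0 mf mg h; apply: le_boxint_ae => //; last by apply: aeN_all => p _.
by move=> p; exact: le_trans (h p).
Qed.

Lemma eq_boxint N (f g : 'rV[R]_N -> \bar R) : f =1 g -> boxint M f = boxint M g.
Proof. by move=> /funext ->. Qed.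

Lemma boxintD N (f g : 'rV[R]_N -> \bar R) :
  (forall p, (0 <= f p)%E) -> (forall p, (0 <= g p)%E) -> measR f -> measR g ->
  (boxint M (fun p => f p + g p) = boxint M f + boxint M g)%E.
Proof.
elim: N f g => [|N IH] f g f0 g0 mf mg //=.
rewrite -ge0_integralD //; try exact: measurable_slice_boxint.
- by apply: eq_integral => x _; rewrite IH //; exact: measR_slice.
- exact: measurable_symitv.
- by move=> x _; exact: boxint_ge0.
- by move=> x _; exact: boxint_ge0.
Qed.

Lemma boxintZ N (c : R) (f : 'rV[R]_N -> \bar R) : 0 <= c ->
  (forall p, (0 <= f p)%E) -> measR f ->
  (boxint M (fun p => c%:E * f p) = c%:E * boxint M f)%E.
Proof.
move=> c0; elim: N f => [|N IH] f f0 mf //=.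
rewrite -ge0_integralZl ?lee_fin //; try exact: measurable_slice_boxint.
- by apply: eq_integral => x _; rewrite IH //; exact: measR_slice.
- exact: measurable_symitv.
- by move=> x _; exact: boxint_ge0.
Qed.

Lemma lebesgue_symitv : @lebesgue_measure R (symitv M) = (M + M)%:E.
Proof.
rewrite /symitv lebesgue_measure_itv /= lte_fin; case: ltP => h.
  by rewrite -EFinB opprK.
have -> : M = 0 by apply/eqP; rewrite eq_le M0 andbT; lra.
by rewrite addr0.
Qed.

Lemma integral_symitv_cst (c : R) :
  (\int[@lebesgue_measure R]_(x in symitv M) c%:E = (c * (M + M))%:E)%E.
Proof.
have := integral_cst (@lebesgue_measure R) (measurable_symitv_lebesgue M) c%:E.
by rewrite /= => ->; rewrite [X in (_ * X)%E](_ : _ = (M + M)%:E) //; exact: lebesgue_symitv.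
Qed.

Lemma boxint_cst N (c : R) :
  boxint M (fun _ : 'rV[R]_N => c%:E) = (c * (M + M) ^+ N)%:E.
Proof.
elim: N c => [|N IH] c /=; first by rewrite mulr1.
under eq_integral do rewrite IH.
by rewrite integral_symitv_cst exprSr mulrA.
Qed.

(** Dominated convergence, one coordinate at a time: the inner integrals are at most
    [A * (M + M) ^+ N], a constant and hence integrable on the bounded interval. *)
Lemma boxint_bounded_cvg N (h : nat -> 'rV[R]_N -> \bar R) (A : R) :
  (forall n p, (0 <= h n p <= A%:E)%E) -> (forall n, measR (h n)) ->
  aeN (fun p => h^~ p @ \oo --> 0%E) ->
  boxint M (h n) @[n --> \oo] --> 0%E.
Proof.
elim: N h => [|N IH] h hA mh //= ae0.
have h0 n p : (0 <= h n p)%E by case/andP: (hA n p).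
have [|||||_ _] := @dominated_convergence _ _ R (@lebesgue_measure R) (symitv M)
    (measurable_symitv M)
    (fun n x => boxint M (fun v => h n (consrv x v))) (cst 0%E)
    (cst (A * (M + M) ^+ N)%:E).
- by move=> n; exact: measurable_slice_boxint.
- exact: measurable_cst.
- apply: aelebS ae0 => x hx _; apply: IH => // n; exact: measR_slice.
- apply/integrableP; split; first exact: measurable_cst.
  by under eq_integral do rewrite /=; rewrite integral_symitv_cst ltry.
- apply: aeW => x n _; rewrite gee0_abs ?boxint_ge0 // -boxint_cst.
  apply: le_boxint => //; [exact: measR_slice|exact: measR_cst|].
  by move=> p; case/andP: (hA n (consrv x p)).
by under [X in _ --> X -> _]eq_integral do rewrite /cst; rewrite integral_symitv_cst mul0r.
Qed.

Lemma measR_EFin N (f : 'rV[R]_N -> R) : measR f -> measR (fun p => (f p)%:E).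
Proof. by apply: measR_comp; exact/measurable_EFinP. Qed.

(* [w <= min(w, A) + w^2 / A]: the first term is handled by bounded convergence, the
   second one is small uniformly in [n] for large [A]. *)
Lemma boxint_L2_cvg0 N (w : nat -> 'rV[R]_N -> R) (C : R) :
  (forall n p, 0 <= w n p) -> (forall n, measR (w n)) ->
  aeN (fun p => w^~ p @ \oo --> 0) ->
  (\forall n \near \oo, (boxint M (fun p => (w n p ^+ 2)%:E) <= C%:E)%E) ->
  forall e : R, 0 < e -> \forall n \near \oo, (boxint M (fun p => (w n p)%:E) <= e%:E)%E.
Proof.
move=> w0 mw ae0 hC e e0.
(* Chosen so that C / A <= e / 2; taking |C| + 1 makes A positive whatever the sign of C. *)
pose A : R := 2 * (`|C| + 1) / e.
have C1 : 0 < `|C| + 1 by rewrite ltr_wpDl.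
have A0 : 0 < A by rewrite divr_gt0 // mulr_gt0.
have mmin n : measR (fun p => (Order.min (w n p) A)%:E).
  apply: measR_EFin; apply: (measR_fun1 (g := fun x => Order.min x A)) => //.
  by apply: measurable_minr => //; exact: measurable_cst.
have msq n : measR (fun p => (w n p ^+ 2)%:E).
  by apply: measR_EFin; apply: (measR_fun1 (g := fun x => x ^+ 2)).
have : boxint M (fun p => (Order.min (w n p) A)%:E) @[n --> \oo] --> 0%E.
  apply: (@boxint_bounded_cvg _ _ A) => //.
    by move=> n p; rewrite !lee_fin le_min w0 ltW //= ge_min lexx orbT.
  apply: aeN_imply ae0 => p wp.
  apply: cvg_EFin; first by apply: nearW.
  apply: (@squeeze_cvgr _ _ _ _ (cst 0) (w^~ p)) => //; last exact: cvg_cst.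
  by apply: nearW => n /=; rewrite le_min w0 ltW //= ge_min lexx.
have e2 : 0 < e / 2 by rewrite divr_gt0.
move=> /fine_cvgP[fin /cvgrPdist_le/(_ (e / 2) e2)] hmin.
near=> n.
have h1 : (boxint M (fun p => (Order.min (w n p) A)%:E) <= (e / 2)%:E)%E.
  rewrite -(@fineK _ (boxint M _)); last by near: n.
  rewrite lee_fin; apply: le_trans (ler_norm _) _; rewrite -normrN -sub0r.
  by near: n.
have h2 : (boxint M (fun p => (A^-1 * (w n p ^+ 2))%:E) <= (e / 2)%:E)%E.
  under eq_boxint do rewrite EFinM.
  rewrite boxintZ ?invr_ge0 ?(ltW A0) //; last by move=> p; rewrite lee_fin sqr_ge0.
  apply: (@le_trans _ _ (A^-1%:E * C%:E)%E).
    by apply: lee_wpmul2l; [rewrite lee_fin invr_ge0 ltW|near: n].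
  rewrite -EFinM lee_fin mulrC ler_pdivrMr // /A.
  have -> : e / 2 * (2 * (`|C| + 1) / e) = `|C| + 1 by field; rewrite gt_eqF.
  by apply: le_trans (ler_norm C) _; rewrite lerDl.
apply: (@le_trans _ _ ((e / 2)%:E + (e / 2)%:E)%E); last by rewrite -EFinD -splitr.
apply: le_trans (leeD h1 h2).
rewrite -boxintD //.
- apply: le_boxint.
  + by move=> p; rewrite lee_fin.
  + exact: measR_EFin.
  + apply: measR_EFin; apply: (measR_fun1 (g := fun x => Order.min x A + A^-1 * x ^+ 2)) => //.
    apply: measurable_funD; first by apply: measurable_minr => //; exact: measurable_cst.
    by apply: measurable_funM; [exact: measurable_cst|exact: measurable_funX].
  + move=> p; rewrite -EFinD lee_fin minEle; case: ifP => [_|/negbT].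
      by rewrite lerDl mulr_ge0 ?invr_ge0 ?sqr_ge0 // ltW.
    rewrite -ltNge => /ltW Aw; apply: (@le_trans _ _ (A^-1 * w n p ^+ 2)); last by rewrite lerDr ltW.
    by rewrite mulrC ler_pdivlMr // expr2 ler_wpM2l.
- by move=> p; rewrite lee_fin le_min w0 ltW.
- by move=> p; rewrite lee_fin mulr_ge0 ?invr_ge0 ?sqr_ge0 // ltW.
- apply: measR_EFin; apply: (measR_fun1 (g := fun x => A^-1 * x ^+ 2)) => //.
  by apply: measurable_funM; [exact: measurable_cst|exact: measurable_funX].
Unshelve. all: by end_near. Qed.

Lemma iint0 N : iint (fun _ : 'rV[R]_N => 0 : R) = 0.
Proof.
elim: N => [|N IH] //=; under eq_Rintegral do rewrite IH.
by rewrite /Rintegral integral0.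
Qed.

Lemma iint_slice0 N (f : 'rV[R]_N.+1 -> R) (x : R) :
  (forall p, M < `|p| -> f p = 0) -> ~ symitv M x -> iint (fun v => f (consrv x v)) = 0.
Proof.
move=> sf nx; rewrite -(iint0 N); congr iint; apply/funext => v; apply: sf.
rewrite ltNge; apply/negP => /(norm_consrv_le _ _ M0)[+ _].
by rewrite ler_norml => h; apply: nx; rewrite /symitv /= in_itv /= h.
Qed.

Lemma slice_supp N (f : 'rV[R]_N.+1 -> R) (x : R) :
  (forall p, M < `|p| -> f p = 0) -> forall v, M < `|v| -> f (consrv x v) = 0.
Proof.
move=> sf v; rewrite ltNge => /negP h; apply: sf; rewrite ltNge; apply/negP.
by move=> /(norm_consrv_le _ _ M0)[_].
Qed.

Lemma measR_normE N (f : 'rV[R]_N -> R) : measR f -> measR (fun p => `|f p|%:E).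
Proof.
move=> mf; apply: measR_EFin; apply: (measR_fun1 (g := Num.norm)) => //.
Qed.

Lemma measurable_slice_iint N (f : 'rV[R]_N.+1 -> R) : measR f ->
  measurable_fun setT (fun x : R => iint (fun v => f (consrv x v))).
Proof. by move=> mf; apply: measurable_iint; exact: measN_slice. Qed.

Lemma abse_fine_le (x : \bar R) : (`|fine x|%:E <= `|x|)%E.
Proof. by case: x => [r| |] //=; rewrite leey. Qed.

Lemma integral_symitv_supp (F : R -> \bar R) : (forall x, ~ symitv M x -> F x = 0%E) ->
  (\int[@lebesgue_measure R]_x F x = \int[@lebesgue_measure R]_(x in symitv M) F x)%E.
Proof.
move=> h; rewrite [RHS]integral_mkcond; apply: eq_integral => x _.
by rewrite patchE; case: ifPn => // /negP; rewrite inE => /h.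
Qed.

(* No integrability is needed: where an inner integral diverges, [fine] makes the
   left-hand side [0]. *)
Lemma iint_norm_le N (f : 'rV[R]_N -> R) : measR f -> (forall p, M < `|p| -> f p = 0) ->
  (`|iint f|%:E <= boxint M (fun p => `|f p|%:E))%E.
Proof.
elim: N f => [|N IH] f mf sf //=.
apply: le_trans (abse_fine_le _) _.
have mF := measurable_slice_iint mf.
apply: le_trans.
  by apply: le_abse_integral => //; exact/measurable_EFinP.
rewrite integral_symitv_supp; last by move=> x nx; rewrite (iint_slice0 sf nx) /= normr0.
apply: ge0_le_integral => //.
- by apply: measurable_funTS; apply: measurableT_comp => //; exact/measurable_EFinP.
- by apply: (@measurable_slice_boxint _ (fun p => `|f p|%:E)) => //; exact: measR_normE.
- move=> x _; apply: IH; [exact: measR_slice|exact: slice_supp].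
Qed.

Lemma integrable_slice_iint N (f : 'rV[R]_N.+1 -> R) :
  measR f -> (forall p, M < `|p| -> f p = 0) ->
  (boxint M (fun p => `|f p|%:E) < +oo)%E ->
  (@lebesgue_measure R).-integrable setT (EFin \o (fun x : R => iint (fun v => f (consrv x v)))).
Proof.
move=> mf sf hf.
have mF := measurable_slice_iint mf.
apply/integrableP; split; first exact/measurable_EFinP.
apply: le_lt_trans hf.
rewrite integral_symitv_supp; last by move=> x nx /=; rewrite (iint_slice0 sf nx) /= normr0.
apply: ge0_le_integral => //.
- by apply: measurable_funTS; apply: measurableT_comp => //; exact/measurable_EFinP.
- by apply: (@measurable_slice_boxint _ (fun p => `|f p|%:E)) => //; exact: measR_normE.
- move=> x _; apply: iint_norm_le; [exact: measR_slice|exact: slice_supp].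
Qed.

Lemma ae_slice_boxint_fin N (f : 'rV[R]_N.+1 -> \bar R) :
  (forall p, (0 <= f p)%E) -> measR f -> (boxint M f < +oo)%E ->
  {ae @lebesgue_measure R, forall x, symitv M x -> (boxint M (fun v => f (consrv x v)) < +oo)%E}.
Proof.
move=> f0 mf hf.
have : (@lebesgue_measure R).-integrable (symitv M) (fun x => boxint M (fun v => f (consrv x v))).
  apply/integrableP; split; first exact: measurable_slice_boxint.
  under eq_integral do rewrite gee0_abs ?boxint_ge0 //.
  exact: hf.
move=> /integrable_ae; move=> /(_ (measurable_symitv M)).
by apply: aelebS => x /[apply]; rewrite fin_numElt => /andP[].
Qed.

(** Linearity of the iterated integral is at stake, and it can fail when the default value 0 of a
    divergent integral intervenes; hence the two finiteness hypotheses. They pass only to almost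
    every slice, so the slices are compared almost everywhere. *)
Lemma iint_dist_le N (f g : 'rV[R]_N -> R) : measR f -> measR g ->
  (forall p, M < `|p| -> f p = 0) -> (forall p, M < `|p| -> g p = 0) ->
  (boxint M (fun p => `|f p|%:E) < +oo)%E -> (boxint M (fun p => `|g p|%:E) < +oo)%E ->
  (`|iint f - iint g|%:E <= boxint M (fun p => `|f p - g p|%:E))%E.
Proof.
elim: N f g => [|N IH] f g mf mg sf sg hf hg //=.
have mF := measurable_slice_iint mf.
have mG := measurable_slice_iint mg.
rewrite -RintegralB //; try exact: integrable_slice_iint.
apply: le_trans (abse_fine_le _) _.
have mFG : measurable_fun setT (fun x : R =>
    (iint (fun v => f (consrv x v)) - iint (fun v => g (consrv x v)))%:E).
  by apply/measurable_EFinP; exact: measurable_funB.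
apply: le_trans.
  by apply: le_abse_integral => //; exact: mFG.
rewrite integral_symitv_supp; last first.
  by move=> x nx; rewrite (iint_slice0 sf nx) (iint_slice0 sg nx) subr0 /= normr0.
apply: ae_ge0_le_integral => //.
- by apply: measurable_funTS; apply: measurableT_comp => //; exact: mFG.
- by move=> x _; exact: boxint_ge0.
- apply: (@measurable_slice_boxint _ (fun p => `|f p - g p|%:E)) => //; apply: measR_normE.
  apply: (measR_fun2 (g := fun y z => y - z)) => //.
  by apply: measurable_funB; [exact: measurable_fst|exact: measurable_snd].
have af := @ae_slice_boxint_fin _ (fun p => `|f p|%:E)
  (fun p => normr_ge0 (f p)) (measR_normE mf) hf.
have ag := @ae_slice_boxint_fin _ (fun p => `|g p|%:E)
  (fun p => normr_ge0 (g p)) (measR_normE mg) hg.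
apply: aelebS2 af ag => x h1 h2 Dx.
by apply: IH; [exact: measR_slice|exact: measR_slice|exact: slice_supp|exact: slice_supp
  |exact: h1|exact: h2].
Qed.
Lemma measR_mul N (f g : 'rV[R]_N -> R) : measR f -> measR g -> measR (fun p => f p * g p).
Proof.
apply: (measR_fun2 (g := fun y z => y * z)).
by apply: measurable_funM; [exact: measurable_fst|exact: measurable_snd].
Qed.

Lemma measR_add N (f g : 'rV[R]_N -> R) : measR f -> measR g -> measR (fun p => f p + g p).
Proof.
apply: (measR_fun2 (g := fun y z => y + z)).
by apply: measurable_funD; [exact: measurable_fst|exact: measurable_snd].
Qed.

Lemma measR_sub N (f g : 'rV[R]_N -> R) : measR f -> measR g -> measR (fun p => f p - g p).
Proof.
apply: (measR_fun2 (g := fun y z => y - z)).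
by apply: measurable_funB; [exact: measurable_fst|exact: measurable_snd].
Qed.

Lemma measR_sqr N (f : 'rV[R]_N -> R) : measR f -> measR (fun p => f p ^+ 2).
Proof. by apply: (measR_fun1 (g := fun y => y ^+ 2)). Qed.

Lemma measR_norm N (f : 'rV[R]_N -> R) : measR f -> measR (fun p => `|f p|).
Proof. by apply: (measR_fun1 (g := Num.norm)). Qed.

(** A cube has finite volume, so |f| <= 1 + f^2 does the work of Cauchy-Schwarz. *)
Lemma boxint_norm_fin N (f : 'rV[R]_N -> R) (C : R) : measR f ->
  (boxint M (fun p => (f p ^+ 2)%:E) <= C%:E)%E -> (boxint M (fun p => `|f p|%:E) < +oo)%E.
Proof.
move=> mf hC.
have mf2 := measR_EFin (measR_sqr mf).
apply: (@le_lt_trans _ _ (boxint M (fun p => 1%:E + (f p ^+ 2)%:E)%E)).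
  apply: le_boxint => //.
  - exact: measR_normE.
  - by apply: measR_EFin; apply: measR_add; [exact: measR_cst|exact: measR_sqr].
  - move=> p; rewrite -EFinD lee_fin -real_normK ?num_real //.
    by have := sqr_ge0 (`|f p| - 1); rewrite sqrrB expr1n; have := normr_ge0 (f p); lra.
rewrite boxintD //; [|by move=> p; rewrite lee_fin sqr_ge0|exact: measR_cst].
rewrite boxint_cst; apply: le_lt_trans (leeD (lexx _) hC) _.
by rewrite -EFinD ltry.
Qed.

Lemma boxint_mul_fin N (f phi : 'rV[R]_N -> R) (B : R) : 0 <= B ->
  measR f -> measR phi -> (forall p, `|phi p| <= B) ->
  (boxint M (fun p => `|f p|%:E) < +oo)%E -> (boxint M (fun p => `|f p * phi p|%:E) < +oo)%E.
Proof.
move=> B0 mf mphi hB hf.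
apply: (@le_lt_trans _ _ (boxint M (fun p => B%:E * `|f p|%:E)%E)).
  apply: le_boxint => //.
  - by apply: measR_normE; exact: measR_mul.
  - by apply: measR_EFin; apply: measR_mul; [exact: measR_cst|exact: measR_norm].
  - by move=> p; rewrite -EFinM lee_fin normrM mulrC ler_wpM2r.
rewrite boxintZ //; last exact: measR_normE.
have h0 : (0 <= boxint M (fun p => `|f p|%:E))%E by apply: boxint_ge0.
move: hf h0; case: (boxint _ _) => [r| |] //= _ _.
by rewrite -EFinM ltry.
Qed.

(** The two integrals differ by at most B times the L^1 norm of u_n - v on the cube, which tends to
    0 by [boxint_L2_cvg0]. Integrability of u_n itself is recovered, for n large, from that of v and
    of the difference. *)
Lemma cvg_iint_mul N (u : nat -> 'rV[R]_N -> R) (v phi : 'rV[R]_N -> R) (B C C' : R) :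
  (forall n, measR (u n)) -> measR v -> measR phi ->
  0 <= B -> (forall p, `|phi p| <= B) -> (forall p, M < `|p| -> phi p = 0) ->
  aeN (fun p => u^~ p @ \oo --> v p) ->
  (boxint M (fun p => (v p ^+ 2)%:E) <= C'%:E)%E ->
  (\forall n \near \oo, (boxint M (fun p => (`|u n p - v p| ^+ 2)%:E) <= C%:E)%E) ->
  iint (fun p => u n p * phi p) @[n --> \oo] --> iint (fun p => v p * phi p).
Proof.
move=> mu mv mphi B0 hB sphi ae hv hw.
pose w n p := `|u n p - v p|.
have mw n : measR (w n) by apply: measR_norm; exact: measR_sub.
have w0 n p : 0 <= w n p by exact: normr_ge0.
have aew : aeN (fun p => w^~ p @ \oo --> 0).
  apply: aeN_imply ae => p /cvgrPdist_le up; apply/cvgrPdist_le => e e0.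
  by apply: filterS (up e e0) => n; rewrite /w sub0r normrN normr_id distrC.
have hsmall := boxint_L2_cvg0 w0 mw aew hw.
have fv := boxint_norm_fin mv hv.
apply/cvgrPdist_le => e e0.
(* Dividing by B + 1 rather than B covers B = 0. *)
have e1 : 0 < e / (B + 1) by rewrite divr_gt0 // ltr_wpDl.
near=> n.
have h1 : (boxint M (fun p => (w n p)%:E) <= (e / (B + 1))%:E)%E by near: n; exact: hsmall.
have fu : (boxint M (fun p => `|u n p|%:E) < +oo)%E.
  apply: (@le_lt_trans _ _ (boxint M (fun p => `|v p|%:E + (w n p)%:E)%E)).
    apply: le_boxint => //.
    - exact: measR_normE.
    - by apply: measR_EFin; apply: measR_add => //; exact: measR_norm.
    - move=> p; rewrite -EFinD lee_fin /w; apply: le_trans (ler_normD _ _).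
      by rewrite addrC subrK.
  rewrite boxintD; [|by move=> p; rewrite lee_fin|by move=> p; rewrite lee_fin
    |exact: measR_normE|exact: measR_EFin].
  by rewrite lte_add_pinfty //; apply: le_lt_trans h1 _; rewrite ltry.
rewrite distrC -lee_fin; apply: le_trans.
  apply: (iint_dist_le (measR_mul (mu n) mphi) (measR_mul mv mphi)).
  - by move=> p pM; rewrite sphi // mulr0.
  - by move=> p pM; rewrite sphi // mulr0.
  - exact: (boxint_mul_fin B0).
  - exact: (boxint_mul_fin B0).
apply: (@le_trans _ _ (boxint M (fun p => B%:E * (w n p)%:E)%E)).
  apply: le_boxint => //.
  - by apply: measR_normE; apply: measR_sub; exact: measR_mul.
  - by apply: measR_EFin; apply: measR_mul => //; exact: measR_cst.
  - by move=> p; rewrite -EFinM lee_fin -mulrBl normrM mulrC ler_wpM2r.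
rewrite boxintZ //; [|by move=> p; rewrite lee_fin|exact: measR_EFin].
apply: le_trans (lee_wpmul2l _ h1) _; first by rewrite lee_fin.
rewrite -EFinM lee_fin mulrA ler_pdivrMr ?ltr_wpDl // mulrC ler_wpM2l ?ltW //.
by rewrite ltrDl.
Unshelve. all: by end_near. Qed.
End BoxIntegral.

Local Open Scope complex_scope.

(** * Logarithms of polynomials *)

Section Cabs.
Context (R : realType).
Implicit Types z w : R[i].

Lemma cabs_ge0 z : 0 <= cabs z.
Proof. by case: z => x y; exact: sqrtr_ge0. Qed.

Lemma cabsM z w : cabs (z * w) = cabs z * cabs w.
Proof. exact: Normc.normcM. Qed.

Lemma cabsD z w : cabs (z + w) <= cabs z + cabs w.
Proof. exact: le_normcD. Qed.

Lemma cabs0 : cabs (0 : R[i]) = 0.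
Proof. exact: Normc.normc0. Qed.

Lemma cabs1 : cabs (1 : R[i]) = 1.
Proof. exact: Normc.normc1. Qed.

Lemma cabs_eq0 z : (cabs z == 0) = (z == 0).
Proof.
by apply/eqP/eqP => [/Normc.eq0_normc //|->]; exact: cabs0.
Qed.

Lemma cabs_gt0 z : (0 < cabs z) = (z != 0).
Proof. by rewrite lt_def cabs_ge0 andbT cabs_eq0. Qed.

Lemma cabsX z n : cabs (z ^+ n) = cabs z ^+ n.
Proof. by elim: n => [|n IH]; rewrite ?expr0 ?cabs1 // !exprS cabsM IH. Qed.

Lemma cabs_prod (I : Type) (s : seq I) (P : pred I) (F : I -> R[i]) :
  cabs (\prod_(i <- s | P i) F i) = \prod_(i <- s | P i) cabs (F i).
Proof. by apply: (big_morph (@cabs R) cabsM cabs1). Qed.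

Lemma cabs_sum_le (I : Type) (s : seq I) (P : pred I) (F : I -> R[i]) :
  cabs (\sum_(i <- s | P i) F i) <= \sum_(i <- s | P i) cabs (F i).
Proof.
elim/big_ind2 : _ => [|z x w y zx wy|//]; first by rewrite cabs0.
by apply: le_trans (cabsD _ _) _; exact: lerD.
Qed.

Lemma cabs_real (x : R) : cabs (x%:C) = `|x|.
Proof. by rewrite /cabs /= expr0n /= addr0 sqrtr_sqr. Qed.

Lemma cabs_Re z : `|complex.Re z| <= cabs z.
Proof.
case: z => x y; rewrite /cabs /= -sqrtr_sqr ler_sqrt ?addr_ge0 ?sqr_ge0 //.
by rewrite lerDl sqr_ge0.
Qed.
End Cabs.

Section LogDrop.
Context (R : realType).
Implicit Types (x y z : R).

(* [ln] is [0] on nonpositive numbers, and the triangle inequality holds there as well. *)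
Definition logdrop x y : R := Num.max 0 (ln x - ln y).

Lemma logdrop_ge0 x y : 0 <= logdrop x y.
Proof. by rewrite /logdrop le_max lexx. Qed.

Lemma logdrop_tri x y z : logdrop x z <= logdrop x y + logdrop y z.
Proof.
rewrite /logdrop !maxEle; case: ifP => h1; case: ifP => h2; case: ifP => h3; lra.
Qed.

Lemma measurable_logdrop x : measurable_fun setT (logdrop x).
Proof.
apply: measurable_maxr; first exact: measurable_cst.
by apply: measurable_funB; [exact: measurable_cst|exact: measurable_ln].
Qed.
End LogDrop.

(** * An integrable majorant for the square of a logarithm *)

Section Shells.
Context (R : realType) (T : R) (T0 : 0 <= T).
Local Notation mu := (@lebesgue_measure R).

Definition shell (r : R) (k : nat) : set R := `[r - T / 4 ^+ k, r + T / 4 ^+ k]%classic.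

(* [shellsum r x] grows like [|x - r|^(-1/2)] near [r], hence dominates the square of a
   logarithm, and its integral is a geometric series. *)
Definition shellterm (r : R) (k : nat) (x : R) : R := 2 ^+ k * \1_(shell r k) x.

Definition shellsum (r x : R) : \bar R :=
  (\sum_(0 <= k <oo) (shellterm r k x)%:E)%E.

Lemma measurable_shell r k : measurable (shell r k).
Proof. exact: measurable_itv. Qed.

Lemma measurable_shellterm r k (D : set R) :
  measurable_fun D (fun x => (shellterm r k x)%:E).
Proof.
apply: measurable_funTS; apply/measurable_EFinP; apply: measurable_funM.
  exact: measurable_cst.
by apply: measurable_indic; exact: measurable_shell.
Qed.

Lemma shellterm_ge0 r k x : (0 <= (shellterm r k x)%:E)%E.
Proof. by rewrite lee_fin /shellterm mulr_ge0. Qed.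

Lemma shellsum_ge0 r x : (0 <= shellsum r x)%E.
Proof. by apply: nneseries_ge0 => k _ _; exact: shellterm_ge0. Qed.

Lemma measurable_shellsum r (D : set R) : measurable D -> measurable_fun D (shellsum r).
Proof.
move=> mD; apply: (@ge0_emeasurable_sum _ _ _ D (fun k x => (shellterm r k x)%:E) xpredT).
  by move=> k x _ _; exact: shellterm_ge0.
by move=> k _; exact: measurable_shellterm.
Qed.

Lemma integral_shellsum r (D : set (measurableTypeR R)) : measurable D ->
  (\int[mu]_(x in D) shellsum r x <= (4 * T)%:E)%E.
Proof.
move=> mD; rewrite /shellsum integral_nneseries //; last 2 first.
- by move=> k; exact: measurable_shellterm.
- by move=> k x _; exact: shellterm_ge0.
(* Length 2T / 4^k times weight 2^k; these bounds sum to 4T. *)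
have step k : (\int[mu]_(x in D) (shellterm r k x)%:E <= (2 * T / 2 ^+ k)%:E)%E.
  under eq_integral do rewrite /shellterm EFinM.
  have mI : measurable_fun D (fun x => (\1_(shell r k) x : R)%:E).
    apply: measurable_funTS; apply/measurable_EFinP; apply: measurable_indic.
    exact: measurable_shell.
  have I0 x : D x -> (0 <= (\1_(shell r k) x : R)%:E)%E by rewrite lee_fin.
  have c0 : (0 <= (2 ^+ k : R)%:E)%E by rewrite lee_fin.
  rewrite (@ge0_integralZl _ _ _ mu D mD _ mI _ I0 c0).
  rewrite integral_indic //; last exact: measurable_shell.
  have h : (mu (shell r k `&` D) <= (2 * T / 4 ^+ k)%:E)%E.
    apply: (@le_trans _ _ (mu (shell r k))).
      apply: le_measure; rewrite ?inE //; last exact: measurable_shell.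
      by apply: measurableI => //; exact: measurable_shell.
    rewrite /shell lebesgue_measure_itv /= lte_fin; case: ifP => _.
      by rewrite -EFinB lee_fin; lra.
    by rewrite lee_fin !mulr_ge0 ?invr_ge0.
  apply: le_trans (lee_wpmul2l _ h) _; first by rewrite lee_fin.
  rewrite -EFinM lee_fin (_ : 4 = 2 * 2) ?exprMn; last by ring.
  rewrite le_eqVlt; apply/orP; left; apply/eqP; field.
  by rewrite expf_neq0 // pnatr_eq0.
apply: lime_le.
  by apply: is_cvg_nneseries => k _ _; apply: integral_ge0 => x _; exact: shellterm_ge0.
apply: nearW => n.
apply: (@le_trans _ _ (\sum_(0 <= k < n) (2 * T / 2 ^+ k)%:E)%E).
  by apply: lee_sum => k _; exact: step.
rewrite sumEFin lee_fin.
suff -> : \sum_(0 <= k < n) 2 * T / 2 ^+ k = 4 * T - 4 * T / 2 ^+ n.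
  by rewrite gerBl !mulr_ge0 ?invr_ge0.
elim: n => [|n IH]; first by rewrite big_geq // expr0; field.
rewrite big_nat_recr //= IH exprS; field.
by rewrite expf_neq0 // pnatr_eq0.
Qed.

(** For k >= 1, passing to k + 1 at most doubles the square, as (k + 3)^2 <= 2 (k + 2)^2; at k = 0
    this fails (9 > 8), so that case is checked apart. *)
Lemma sqr_le_pow2 (k : nat) : ((k + 2) ^ 2 <= 16 * 2 ^ k)%N.
Proof.
case: k => [//|k]; elim: k => [//|k IH].
apply: leq_trans (_ : 2 * ((k.+1 + 2) ^ 2) <= _)%N; last first.
  by rewrite [in X in (_ <= X)%N]expnS mulnCA leq_pmul2l.
rewrite !expnS !expn0 !muln1; lia.
Qed.

(** For t <= T, take the least k with T < t 4^(k+1). Then x lies in the k-th shell, and 1 + T/t <=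
    4^(k+2) gives a logarithm of at most 3 (k + 2), whose square the weight 2^k dominates up to a
    constant. For t > T the logarithm is at most 1, which the summand 1 absorbs. In the application
    r is the real part of a complex root and t the distance from x to that root. *)
Lemma ln_sqr_le_shellsum : exists2 c : R, 0 <= c &
  forall r x t : R, 0 < t -> `|x - r| <= t ->
  ((ln (1 + T / t) ^+ 2)%:E <= 1%:E + c%:E * shellsum r x)%E.
Proof.
(* 9 is the square of the bound 3 on ln 4, and 16 comes from [sqr_le_pow2]. *)
have [c [c0 cE]] : exists c : R, 0 <= c /\ c = 9 * 16 by exists (9 * 16).
exists c => // r x t t0 xt.
have Tt : 0 <= T / t by rewrite divr_ge0 // ltW.
have ln0 : 0 <= ln (1 + T / t) by rewrite ln_ge0 // lerDl.
have ltt : ln (1 + T / t) <= T / t by rewrite le_ln1Dx //; lra.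
have [Tlt|tT] := ltP T t.
  apply: (@le_trans _ _ 1%E); last first.
    by rewrite leeDl // mule_ge0 ?lee_fin // shellsum_ge0.
  rewrite lee_fin expr_le1 //; apply: le_trans ltt _.
  by rewrite ler_pdivrMr // mul1r ltW.
have ex : exists k : nat, T < t * 4 ^+ k.+1.
  exists (Num.truncn (T / t)).+1.
  have h1 : T / t < (Num.truncn (T / t)).+1%:R by exact: truncnS_gt.
  rewrite mulrC -ltr_pdivrMr //; apply: lt_le_trans h1 _.
  rewrite -natrX ler_nat; apply: leq_trans (_ : _ <= 4 ^ (Num.truncn (T / t)).+1)%N _.
    by rewrite ltnW // ltn_expl.
  by rewrite leq_exp2l.
have [k Pk kmin] := ex_minnP ex.
have tk : t * 4 ^+ k <= T.
  case: k Pk kmin => [|k] Pk kmin; first by rewrite expr0 mulr1.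
  by rewrite leNgt; apply/negP => /kmin; rewrite ltnn.
have xk : shell r k x.
  rewrite /shell /= in_itv /= -ler_distlC distrC; apply: le_trans xt _.
  by rewrite ler_pdivlMr ?exprn_gt0.
have lk : ln (1 + T / t) <= 3 * (k + 2)%:R.
  apply: (@le_trans _ _ (ln (4 ^+ (k + 2)))).
    rewrite ler_ln ?posrE ?exprn_gt0 //; last by apply: ltr_wpDr.
    have : T / t <= 4 ^+ k.+1 by rewrite ler_pdivrMr // mulrC ltW.
    have : 1 <= 4 ^+ k.+1 :> R by rewrite exprn_ege1 // ler1n.
    rewrite addn2 [in X in _ -> _ -> _ <= X]exprS; lra.
  rewrite lnXn // -[ln 4 *+ _]mulr_natr; apply: ler_wpM2r => //.
  have -> : 4 = 1 + 3 :> R by ring.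
  by apply: le_ln1Dx; lra.
apply: (@le_trans _ _ (c%:E * (2 ^+ k)%:E)%E).
  rewrite -EFinM lee_fin; apply: (@le_trans _ _ ((3 * (k + 2)%:R) ^+ 2)).
    by rewrite ler_pXn2r // nnegrE //; exact: le_trans lk.
  have := sqr_le_pow2 k; rewrite -(ler_nat R) natrM !natrX exprMn cE; lra.
apply: (@le_trans _ _ (c%:E * shellsum r x)%E); last by rewrite leeDr.
apply: lee_wpmul2l; first by rewrite lee_fin.
apply: le_trans (@nneseries_lim_ge _ _ xpredT 0%N k.+1 _); last first.
  by move=> j _ _; exact: shellterm_ge0.
rewrite big_nat_recr //= [X in (_ <= _ + X)%E](_ : _ = (2 ^+ k)%:E); last first.
  by rewrite /shellterm indicE mem_set // mulr1.
by rewrite leeDr // sume_ge0 // => j _; exact: shellterm_ge0.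
Qed.
End Shells.

(** * The estimate for polynomials in one variable *)

Section LogPoly.
Context (R : realType).
Local Notation mu := (@lebesgue_measure R).

Lemma ae_neq (a : R) : {ae mu, forall x, x != a}.
Proof.
exists [set a]; split; first exact: measurable_set1.
  exact: lebesgue_measure_set1.
by move=> x /= /negP; rewrite negbK => /eqP.
Qed.

Lemma ae_horner_neq0 (P : {poly R[i]}) : P != 0 -> {ae mu, forall x, P.[x%:C] != 0}.
Proof.
move=> P0; have [rs Prs] := closed_field_poly_normal P.
have lP : lead_coef P != 0 by rewrite lead_coef_eq0.
suff : {ae mu, forall x : R, forall z, z \in rs -> x%:C != z}.
  apply: aelebS => x h; rewrite Prs hornerZ horner_prod mulf_neq0 //.
  rewrite prodf_seq_neq0; apply/allP => z zrs /=.
  by rewrite hornerXsubC subr_eq0 h.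
elim: rs {Prs} => [|z rs IH]; first exact: aeW.
(* A complex root can only be hit at the real point equal to its real part. *)
apply: aelebS2 (ae_neq (complex.Re z)) IH => x xz h w.
rewrite inE => /orP[/eqP ->|]; last exact: h.
by apply: contra xz => /eqP <-.
Qed.

Lemma ln_prod (I : Type) (s : seq I) (P : pred I) (F : I -> R) :
  (forall i, P i -> 0 < F i) ->
  ln (\prod_(i <- s | P i) F i) = \sum_(i <- s | P i) ln (F i).
Proof.
move=> h; elim: s => [|i s IH]; first by rewrite !big_nil ln1.
rewrite !big_cons; case: ifPn => // Pi; rewrite lnM ?IH // posrE ?h //.
exact: prodr_gt0.
Qed.

(** Cauchy-Schwarz against the constant sequence 1; for n > 0 the induction step amounts to (n a -
    S)^2 >= 0 divided by n. *)
Lemma sqr_sum_le (I : Type) (s : seq I) (F : I -> R) :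
  (\sum_(i <- s) F i) ^+ 2 <= (size s)%:R * \sum_(i <- s) F i ^+ 2.
Proof.
elim: s => [|i s IH]; first by rewrite !big_nil expr0n /= mulr0.
rewrite !big_cons /=; move: IH.
set S := \sum_(j <- s) F j; set Q := \sum_(j <- s) F j ^+ 2; set n := (size s)%:R.
have Q0 : 0 <= Q by apply: sumr_ge0 => j _; exact: sqr_ge0.
have n0 : 0 <= n :> R by [].
rewrite -natr1 -/n; set a := F i => IH.
suff : 2 * a * S <= n * a ^+ 2 + Q by rewrite sqrrD; lra.
have [nz|np] := eqVneq n 0.
  move: IH; rewrite nz mul0r => S0.
  have /eqP -> : S == 0 by rewrite -sqrf_eq0 eq_le S0 sqr_ge0.
  by rewrite mulr0 mul0r add0r.
have {np} np : 0 < n by rewrite lt_def np.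
rewrite -subr_ge0 -(pmulr_rge0 _ np).
apply: (@le_trans _ _ ((n * a - S) ^+ 2)); first exact: sqr_ge0.
rewrite sqrrB; move: IH; set S2 := S ^+ 2; nra.
Qed.

(** Root by root: |x0 - z| <= T + |x - z| is divided by |x - z|, while the constant c cancels. *)
Lemma logdrop_factor_le (c : R[i]) (rs : seq R[i]) (T x0 x : R) : `|x0 - x| <= T ->
  c * \prod_(z <- rs) (x0%:C - z) != 0 -> c * \prod_(z <- rs) (x%:C - z) != 0 ->
  logdrop (cabs (c * \prod_(z <- rs) (x0%:C - z))) (cabs (c * \prod_(z <- rs) (x%:C - z)))
  <= \sum_(z <- rs) ln (1 + T / cabs (x%:C - z)).
Proof.
move=> hT; rewrite !mulf_eq0 !negb_or !prodf_seq_neq0 => /andP[c0 /allP h0] /andP[_ /allP h1].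
have T0 : 0 <= T by apply: le_trans hT.
have p0 z : z \in rs -> 0 < cabs (x0%:C - z) by move=> /h0; rewrite cabs_gt0.
have p1 z : z \in rs -> 0 < cabs (x%:C - z) by move=> /h1; rewrite cabs_gt0.
have pp (F : R[i] -> R) : (forall z, z \in rs -> 0 < F z) -> 0 < \prod_(z <- rs) F z.
  by move=> hF; rewrite big_seq prodr_gt0.
have pT z : z \in rs -> 0 < 1 + T / cabs (x%:C - z).
  by move=> zrs; rewrite ltr_wpDr // divr_ge0 // cabs_ge0.
rewrite /logdrop ge_max; apply/andP; split.
  by rewrite big_seq sumr_ge0 // => z zrs; rewrite ln_ge0 // lerDl divr_ge0 // cabs_ge0.
rewrite !cabsM !cabs_prod !lnM ?posrE ?cabs_gt0 //; try exact: pp.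
rewrite [\prod_(z <- rs) cabs (x0%:C - z)]big_seq [\prod_(z <- rs) cabs (x%:C - z)]big_seq.
rewrite !ln_prod // opprD addrACA subrr add0r -sumrB [leRHS]big_seq.
apply: ler_sum => z zrs; rewrite lerBlDr -lnM ?posrE ?p1 ?pT //.
rewrite ler_ln ?posrE ?mulr_gt0 ?p0 ?p1 ?pT //.
rewrite mulrDl mul1r divfK ?gt_eqF ?p1 // [leRHS]addrC.
have -> : x0%:C - z = (x0 - x)%:C + (x%:C - z) by rewrite rmorphB addrA subrK.
by apply: le_trans (cabsD _ _) _; rewrite cabs_real lerD2r.
Qed.

Lemma integral_logdrop_poly (M : R) : 0 <= M -> exists2 K : R, 0 <= K &
  forall (D : nat) (P : {poly R[i]}) (x0 : R),
  (size P <= D.+1)%N -> symitv M x0 -> P.[x0%:C] != 0 ->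
  measurable_fun [set: R] (fun x : R => cabs P.[x%:C]) ->
  (\int[mu]_(x in symitv M) ((logdrop (cabs P.[x0%:C]) (cabs P.[x%:C])) ^+ 2)%:E
   <= (K * D%:R ^+ 2)%:E)%E.
Proof.
move=> M0; have T0 : 0 <= 2 * M by rewrite mulr_ge0.
have [c c0 hc] := ln_sqr_le_shellsum T0.
(* T = 2M bounds the distance between two points of the interval; K collects the length 2M, from the
   summand 1, and c times the bound 4T of [integral_shellsum]. *)
pose K := M + M + c * (4 * (2 * M)).
have K0 : 0 <= K by rewrite addr_ge0 ?addr_ge0 // !mulr_ge0.
exists K => // D P x0 sP Mx0 Px0 mP; have [rs Prs] := closed_field_poly_normal P.
have P0 : P != 0 by apply: contra_neq Px0 => ->; rewrite horner0.
have lP : lead_coef P != 0 by rewrite lead_coef_eq0.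
have PE x : P.[x] = lead_coef P * \prod_(z <- rs) (x - z).
  rewrite {1}Prs hornerZ horner_prod; congr (_ * _).
  by apply: eq_bigr => z _; rewrite hornerXsubC.
have srs : (size rs <= D)%N.
  by move: sP; rewrite Prs size_scale // size_prod_XsubC ltnS.
pose H (z : R[i]) (x : R) : \bar R := (1%:E + c%:E * shellsum (2 * M) (complex.Re z) x)%E.
have mD := measurable_symitv_lebesgue M.
have H0 z x : (0 <= H z x)%E by rewrite adde_ge0 ?lee_fin // mule_ge0 ?lee_fin // shellsum_ge0.
have mS z : measurable_fun (symitv M) (shellsum (2 * M) (complex.Re z)).
  exact: measurable_shellsum.
have mcS z : measurable_fun (symitv M) (fun x => c%:E * shellsum (2 * M) (complex.Re z) x)%E.
  by apply: emeasurable_funM => //; exact: measurable_cst.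
have mH z : measurable_fun (symitv M) (H z).
  by apply: emeasurable_funD => //; exact: measurable_cst.
have intH z : (\int[mu]_(x in symitv M) H z x <= K%:E)%E.
  rewrite /H (@ge0_integralD _ _ _ mu _ mD (cst 1%:E)) //; last 2 first.
    by move=> x _; rewrite mule_ge0 ?lee_fin // shellsum_ge0.
    exact: mcS.
  rewrite (@ge0_integralZl _ _ _ mu _ mD _ (mS z)) ?lee_fin //; last first.
    by move=> x _; exact: shellsum_ge0.
  rewrite (integral_symitv_cst M0 1) mul1r.
  apply: (@le_trans _ _ ((M + M)%:E + c%:E * (4 * (2 * M))%:E)%E).
    by apply: leeD => //; apply: lee_wpmul2l; rewrite ?lee_fin // integral_shellsum.
  by rewrite -EFinM -EFinD.
pose B (x : R) : \bar R := (D%:R%:E * \sum_(z <- rs) H z x)%E.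
have sH0 x : (0 <= \sum_(z <- rs) H z x)%E by exact: sume_ge0.
have msH : measurable_fun (symitv M) (fun x => \sum_(z <- rs) H z x)%E.
  by apply: emeasurable_sum => z; exact: mH.
apply: (@le_trans _ _ (\int[mu]_(x in symitv M) B x)%E).
  apply: ae_ge0_le_integral => //.
  - by move=> x _; rewrite lee_fin sqr_ge0.
  - apply: measurable_funTS; apply/measurable_EFinP; apply: measurable_funX.
    exact: (measurableT_comp (measurable_logdrop _) mP).
  - by move=> x _; rewrite mule_ge0 // lee_fin.
  - by apply: emeasurable_funM => //; exact: measurable_cst.
  apply: aelebS (ae_horner_neq0 P0) => x Px Mx.
  have hx : `|x0 - x| <= 2 * M.
    move: Mx0 Mx; rewrite /symitv /= !in_itv /= => /andP[a1 a2] /andP[b1 b2].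
    by rewrite ler_norml; apply/andP; split; lra.
  move: Px Px0; rewrite !PE => Px Px0.
  have := logdrop_factor_le hx Px0 Px; set L := logdrop _ _ => hL.
  have L0 : 0 <= L by exact: logdrop_ge0.
  apply: (@le_trans _ _ (D%:R%:E * (\sum_(z <- rs) ln (1 + 2 * M / cabs (x%:C - z)) ^+ 2)%:E)%E).
    rewrite -EFinM lee_fin.
    apply: (@le_trans _ _ ((\sum_(z <- rs) ln (1 + 2 * M / cabs (x%:C - z))) ^+ 2)).
      by rewrite ler_pXn2r // nnegrE; exact: le_trans hL.
    apply: le_trans (sqr_sum_le _ _) _; apply: ler_wpM2r; last by rewrite ler_nat.
    by apply: sumr_ge0 => z _; exact: sqr_ge0.
  apply: lee_wpmul2l; first by rewrite lee_fin.
  rewrite -sumEFin big_seq [leRHS]big_seq; apply: lee_sum => z zrs.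
  move: Px; rewrite mulf_eq0 negb_or prodf_seq_neq0 => /andP[_ /allP/(_ z zrs)] /= xz.
  apply: hc; first by rewrite cabs_gt0.
  by rewrite (_ : x - complex.Re z = complex.Re (x%:C - z)) ?cabs_Re //; case: (z).
rewrite /B (@ge0_integralZl _ _ _ mu _ mD _ msH) ?lee_fin //.
rewrite (@ge0_integral_sum _ _ _ mu _ mD _ _ mH) //.
apply: (@le_trans _ _ (D%:R%:E * (D%:R%:E * K%:E))%E); last first.
  by rewrite -!EFinM lee_fin; lra.
apply: lee_wpmul2l; first by rewrite lee_fin.
apply: (@le_trans _ _ (\sum_(z <- rs) K%:E)%E).
  by apply: lee_sum => z _; exact: intH.
rewrite sumEFin -EFinM lee_fin big_const_seq count_predT iter_addr_0 -[K *+ _]mulr_natl.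
by apply: ler_wpM2r => //; rewrite ler_nat.
Qed.
End LogPoly.

(** * From one variable to several, along lines *)

Section LinePoly.
Context (R : realType).
Local Notation mu := (@lebesgue_measure R).

(** Polynomial along every real line, with the degree controlled there. The condition passes to
    slices and products without multivariate polynomials, and since t is real it also admits complex
    conjugates, hence squared moduli. *)
Definition linepoly (D N : nat) (g : 'rV[R]_N -> R[i]) : Prop :=
  forall p q : 'rV[R]_N, exists2 P : {poly R[i]}, (size P <= D.+1)%N &
    forall t : R, g (p + t *: q) = P.[t%:C].

Lemma linepoly_slice D N (g : 'rV[R]_N.+1 -> R[i]) (x : R) :
  linepoly D g -> linepoly D (fun v => g (consrv x v)).
Proof.
move=> h p q; have [P sP hP] := h (consrv x p) (consrv 0 q).
by exists P => // t; rewrite -hP consrvZ consrvD mulr0 addr0.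
Qed.

Lemma linepoly_first D N (g : 'rV[R]_N.+1 -> R[i]) (v : 'rV[R]_N) :
  linepoly D g -> exists2 P : {poly R[i]}, (size P <= D.+1)%N &
    forall t : R, g (consrv t v) = P.[t%:C].
Proof.
move=> h; have [P sP hP] := h (consrv 0 v) (consrv 1 0).
by exists P => // t; rewrite -hP consrvZ consrvD mulr1 add0r scaler0 addr0.
Qed.

Lemma consrv_eta N (p : 'rV[R]_N.+1) : exists x v, p = consrv x v.
Proof.
exists (p 0 (lshift N (0 : 'I_1))), (\row_j p 0 (rshift 1 j)).
by apply: consrv_eqP => [|j]; rewrite ?consrv_l // consrv_r mxE.
Qed.

(** On the line through p0 in the first direction g is a nonzero polynomial, so almost every slice
    still contains a point, namely (x, v0), where g does not vanish. *)
Lemma linepoly_ae_neq0 D N (g : 'rV[R]_N -> R[i]) (p0 : 'rV[R]_N) :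
  linepoly D g -> g p0 != 0 -> aeN (fun p => g p != 0).
Proof.
elim: N g p0 => [|N IH] g p0 hg; first by rewrite (thinmx0 p0).
have [x0 [v0 ->]] := consrv_eta p0; have [P _ hP] := linepoly_first v0 hg.
rewrite hP => Px0.
have P0 : P != 0 by apply: contra_neq Px0 => ->; rewrite horner0.
rewrite /=; apply: aelebS (ae_horner_neq0 P0) => x Px.
by apply: (IH _ v0); [exact: linepoly_slice|rewrite hP].
Qed.

Lemma measN_fix N d (X : measurableType d) d' (Y : measurableType d')
  (f : X -> 'rV[R]_N -> Y) (v : 'rV[R]_N) : measN f -> measurable_fun setT (f^~ v).
Proof.
elim: N d X f v => [|N IH] d X f v mf; first by rewrite (thinmx0 v).
have [r [w ->]] := consrv_eta v.
apply: (@measurableT_comp _ _ _ _ _ _ (fun xr : X * R => f xr.1 (consrv xr.2 w)) _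
  (fun x => (x, r))); first exact: (IH _ _ _ w mf).
by apply: measurable_fun_pair => //; exact: measurable_cst.
Qed.

(* The bound does not depend on [g]: going from [p0] to [p] one coordinate at a time
   reduces it to polynomials in one variable. *)
Lemma boxint_logdrop (M : R) (N : nat) : 0 <= M -> exists2 K : R, 0 <= K &
  forall (D : nat) (g : 'rV[R]_N -> R[i]) (p0 : 'rV[R]_N),
    linepoly D g -> measR (fun p => cabs (g p)) -> `|p0| <= M -> g p0 != 0 ->
    (boxint M (fun p => (logdrop (cabs (g p0)) (cabs (g p)) ^+ 2)%:E) <= (K * D%:R ^+ 2)%:E)%E.
Proof.
move=> M0; have [K1 K10 hK1] := integral_logdrop_poly M0.
elim: N => [|N [K K0 IH]].
  exists 0 => // D g p0 _ _ _ _ /=.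
  by rewrite (thinmx0 p0) mul0r lee_fin /logdrop subrr maxxx expr0n.
have MM : 0 <= M + M by rewrite addr_ge0.
(* From (u + v)^2 <= 2 u^2 + 2 v^2: the first variable contributes K1 times the volume (2M)^N of the
   slice, the others K times the length 2M. *)
exists (2 * (K1 * (M + M) ^+ N) + 2 * K * (M + M)).
  by rewrite addr_ge0 // !mulr_ge0 // exprn_ge0.
move=> D g p0 hg mg; have [x0 [v0 ->]] := consrv_eta p0.
move=> /(norm_consrv_le _ _ M0)[x0M v0M] gp0.
have Mx0 : symitv M x0 by rewrite /symitv /= in_itv /= -ler_norml.
have [P sP hP] := linepoly_first v0 hg.
have Px0 : P.[x0%:C] != 0 by rewrite -hP.
have P0 : P != 0 by apply: contra_neq Px0 => ->; rewrite horner0.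
have mP : measurable_fun [set: R] (fun x : R => cabs P.[x%:C]).
  under eq_fun do rewrite -hP.
  exact: (measN_fix v0 (measN_slice mg)).
pose L1 x := logdrop (cabs P.[x0%:C]) (cabs P.[x%:C]).
have mL1 : measurable_fun [set: R] (fun x => L1 x ^+ 2).
  by apply: measurable_funX; exact: (measurableT_comp (measurable_logdrop _) mP).
have mD := measurable_symitv_lebesgue M.
have mlog N' (f : 'rV[R]_N' -> R) c : measR f -> measR (fun p => (logdrop c (f p) ^+ 2)%:E).
  move=> mf; apply: measR_EFin; apply: (measR_fun1 (g := fun y => logdrop c y ^+ 2)) => //.
  by apply: measurable_funX; exact: measurable_logdrop.
have sq0 (y : R) : (0 <= (y ^+ 2)%:E)%E by rewrite lee_fin sqr_ge0.
pose c1 : R := 2 * (M + M) ^+ N.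
have c10 : 0 <= c1 by rewrite mulr_ge0 // exprn_ge0.
pose c2 : R := 2 * (K * D%:R ^+ 2).
have c20 : 0 <= c2 by rewrite !mulr_ge0 // exprn_ge0.
apply: (@le_trans _ _ (\int[mu]_(x in symitv M) (c1%:E * (L1 x ^+ 2)%:E + c2%:E))%E).
  rewrite /=; apply: ae_ge0_le_integral => //.
  - by move=> x _; exact: boxint_ge0.
  - by apply: (@measurable_slice_boxint _ M _ (fun p =>
      (logdrop (cabs (g (consrv x0 v0))) (cabs (g p)) ^+ 2)%:E)) => //; exact: mlog.
  - by move=> x _; rewrite -EFinM -EFinD lee_fin addr_ge0 // mulr_ge0 // sqr_ge0.
  - apply: measurable_funTS; apply: emeasurable_funD; last exact: measurable_cst.
    apply: emeasurable_funM; first exact: measurable_cst.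
    exact/measurable_EFinP.
  (* For almost every x the point (x, v0) is again off the zero set, so it can serve as base point
     of its slice. *)
  apply: aelebS (ae_horner_neq0 P0) => x Px Mx.
  have gx : g (consrv x v0) != 0 by rewrite hP.
  have msl := measR_slice x mg.
  have IHx := IH D _ v0 (linepoly_slice x hg) msl v0M gx.
  apply: (@le_trans _ _ (boxint M (fun v => (2 * L1 x ^+ 2)%:E +
      2%:E * (logdrop (cabs (g (consrv x v0))) (cabs (g (consrv x v))) ^+ 2)%:E)%E)).
    apply: le_boxint => //.
    + exact: mlog.
    + apply: measR_EFin; apply: (measR_fun1 (g := fun y =>
        2 * L1 x ^+ 2 + 2 * logdrop (cabs (g (consrv x v0))) y ^+ 2) _ msl).
      apply: measurable_funD; first exact: measurable_cst.
      apply: measurable_funM; first exact: measurable_cst.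
      by apply: measurable_funX; exact: measurable_logdrop.
    + move=> v; rewrite -EFinM -EFinD lee_fin /L1 -hP -hP.
      have := logdrop_tri (cabs (g (consrv x0 v0))) (cabs (g (consrv x v0)))
        (cabs (g (consrv x v))).
      have := logdrop_ge0 (cabs (g (consrv x0 v0))) (cabs (g (consrv x v))).
      set A := logdrop _ _; set B := logdrop _ _; set C := logdrop _ _ => A0 ABC.
      apply: (@le_trans _ _ ((B + C) ^+ 2)).
        by rewrite ler_pXn2r // nnegrE; exact: le_trans ABC.
      by have := sqr_ge0 (B - C); rewrite sqrrB sqrrD; lra.
  rewrite boxintD //; last 4 first.
  - by move=> v; rewrite lee_fin mulr_ge0 // sqr_ge0.
  - by move=> v; rewrite mule_ge0 // lee_fin.
  - exact: measR_cst.
  - apply: measR_EFin; apply: (measR_fun1 (g := fun y =>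
      2 * logdrop (cabs (g (consrv x v0))) y ^+ 2) _ msl).
    apply: measurable_funM; first exact: measurable_cst.
    by apply: measurable_funX; exact: measurable_logdrop.
  rewrite boxint_cst // boxintZ //; last exact: mlog.
  apply: leeD; first by rewrite -EFinM lee_fin /c1; lra.
  apply: le_trans (lee_wpmul2l _ IHx) _; first by rewrite lee_fin.
  by rewrite -EFinM lee_fin.
have mE : measurable_fun (symitv M) (fun x => (L1 x ^+ 2)%:E).
  by apply: measurable_funTS; exact/measurable_EFinP.
have a1 x : symitv M x -> (0 <= c1%:E * (L1 x ^+ 2)%:E)%E.
  by rewrite -EFinM lee_fin mulr_ge0 // sqr_ge0.
have a2 : measurable_fun (symitv M) (fun x => c1%:E * (L1 x ^+ 2)%:E)%E.
  by apply: emeasurable_funM => //; exact: measurable_cst.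
have a3 x : symitv M x -> (0 <= cst c2%:E x)%E by rewrite lee_fin.
have a4 : measurable_fun (symitv M) (cst c2%:E) by exact: measurable_cst.
rewrite (@ge0_integralD _ _ _ mu _ mD _ _ a1 a2 a3 a4).
rewrite (@ge0_integralZl _ _ _ mu _ mD _ mE c1%:E (fun x _ => sq0 (L1 x))) ?lee_fin //.
rewrite (integral_symitv_cst M0 c2).
have h1 := hK1 D P x0 sP Mx0 Px0 mP.
apply: (@le_trans _ _ (c1%:E * (K1 * D%:R ^+ 2)%:E + (c2 * (M + M))%:E)%E).
  by apply: leeD => //; apply: lee_wpmul2l => //; rewrite lee_fin.
by rewrite -EFinM -EFinD lee_fin /c1 /c2; set E := (M + M) ^+ N; set d2 := D%:R ^+ 2; lra.
Qed.
End LinePoly.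

(** * Test functions *)

Section TestFunctions.
Context (R : realType) (N : nat).
Implicit Types f : 'rV[R]_N -> R.

Lemma measR_continuous f : continuous f -> measR f.
Proof.
move=> cf; apply: measN_caratheodory => // v; exact: measurable_cst.
Qed.

Lemma measR_coord (i : 'I_N) : measR (fun p : 'rV[R]_N => p 0 i).
Proof. by apply: measR_continuous => p; exact: coord_continuous. Qed.

Lemma rpartial_supp (M : R) (k : 'I_N) f :
  (forall p, M < `|p| -> f p = 0) -> forall p, M < `|p| -> rpartial k f p = 0.
Proof.
move=> sf p pM; rewrite /rpartial (@near_eq_derive _ _ _ f (cst 0)) ?derive_cst //.
have : nbhs p (ball p (`|p| - M)) by apply: nbhsx_ballx; rewrite subr_gt0.
apply: filterS => q; rewrite -ball_normE /= => pq; apply: sf.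
have := ler_normB p (p - q); rewrite subKr => h.
by have := ler_distD q p 0; rewrite !subr0; lra.
Qed.

Lemma continuous_supp_bounded (M : R) f : continuous f ->
  (forall p, M < `|p| -> f p = 0) -> exists2 B : R, 0 <= B & forall p, `|f p| <= B.
Proof.
move=> cf sf.
pose A : set 'rV[R]_N := [set p | `|p| <= M].
have cA : compact A.
  apply: bounded_closed_compact.
    by exists M; split; [exact: num_real|move=> x Mx p /= pM; apply: le_trans pM (ltW Mx)].
  rewrite (_ : A = Num.norm @^-1` [set x | x <= M]) //.
  by apply: closed_comp => [p _|]; [exact: norm_continuous|exact: closed_le].
have [B [_ hB]] := compact_bounded (continuous_compact (continuous_subspaceT cf) cA).
exists (`|B| + 1); first by rewrite addr_ge0.
move=> p; have [pM|pM] := leP `|p| M; last by rewrite sf // normr0 addr_ge0.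
by apply: hB; [rewrite (le_lt_trans (ler_norm B)) // ltrDl|exists p].
Qed.
End TestFunctions.

(** * Algebraic closure properties of line polynomials and measurable complex functions *)

Section LinePolyClosure.
Context (R : realType) (N : nat).
Implicit Types g h : 'rV[R]_N -> R[i].

Lemma linepoly_le D D' g : (D <= D')%N -> linepoly D g -> linepoly D' g.
Proof.
move=> DD hg p q; have [P sP hP] := hg p q.
by exists P => //; apply: leq_trans sP _.
Qed.

Lemma linepoly_cst D (c : R[i]) : linepoly D (fun _ : 'rV[R]_N => c).
Proof.
move=> p q; exists c%:P => [|t]; last by rewrite hornerC.
by apply: leq_trans (size_polyC_leq1 _) _.
Qed.

Lemma linepolyD D g h : linepoly D g -> linepoly D h -> linepoly D (fun p => g p + h p).
Proof.
move=> hg hh p q; have [P sP hP] := hg p q; have [Q sQ hQ] := hh p q.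
exists (P + Q) => [|t]; last by rewrite hornerD hP hQ.
by apply: leq_trans (size_polyD _ _) _; rewrite geq_max sP.
Qed.

Lemma linepolyM D D' g h :
  linepoly D g -> linepoly D' h -> linepoly (D + D') (fun p => g p * h p).
Proof.
move=> hg hh p q; have [P sP hP] := hg p q; have [Q sQ hQ] := hh p q.
exists (P * Q) => [|t]; last by rewrite hornerM hP hQ.
by apply: leq_trans (size_polyMleq _ _) _; lia.
Qed.

Lemma linepolyX D g n : linepoly D g -> linepoly (n * D) (fun p => g p ^+ n).
Proof.
move=> hg; elim: n => [|n IH]; first by under eq_fun do rewrite expr0; exact: linepoly_cst.
rewrite (_ : (fun p => _) = fun p => g p * g p ^+ n); last by apply/funext => p; rewrite exprS.
by rewrite mulSn; exact: linepolyM hg IH.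
Qed.

Lemma linepoly_sum (I : Type) (s : seq I) (P : pred I) D (F : I -> 'rV[R]_N -> R[i]) :
  (forall i, linepoly D (F i)) -> linepoly D (fun p => \sum_(i <- s | P i) F i p).
Proof.
move=> hF; elim: s => [|i s IH].
  by under eq_fun do rewrite big_nil; exact: linepoly_cst.
rewrite (_ : (fun p => _) = fun p => if P i then F i p + \sum_(j <- s | P j) F j p
  else \sum_(j <- s | P j) F j p); last by apply/funext => p; rewrite big_cons.
by case: (P i) => //; exact: linepolyD (hF i) IH.
Qed.

Lemma linepoly_prod (I : Type) (s : seq I) (P : pred I) D (F : I -> 'rV[R]_N -> R[i]) :
  (forall i, linepoly D (F i)) ->
  linepoly (size s * D) (fun p => \prod_(i <- s | P i) F i p).
Proof.
move=> hF; elim: s => [|i s IH].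
  by under eq_fun do rewrite big_nil; exact: linepoly_cst.
rewrite (_ : (fun p => _) = fun p => if P i then F i p * \prod_(j <- s | P j) F j p
  else \prod_(j <- s | P j) F j p); last by apply/funext => p; rewrite big_cons.
case: (P i) => /=; first by rewrite mulSn; exact: linepolyM (hF i) IH.
by apply: linepoly_le IH; rewrite mulSn leq_addl.
Qed.

(** At a real parameter, conjugating the coefficients conjugates the value. This makes |L_i|^2 a
    polynomial along lines. *)
Lemma linepoly_conj D g : linepoly D g -> linepoly D (fun p => conjc (g p)).
Proof.
move=> hg p q; have [P sP hP] := hg p q.
exists (map_poly (@conjc R) P) => [|t].
  by rewrite size_map_inj_poly //; [exact: can_inj (@conjcK R)|exact: conjc0].
rewrite hP -(horner_map (@conjc R)); congr (_.[_]).
by rewrite /real_complex_def /= oppr0.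
Qed.

Lemma mul_conjc (z : R[i]) : z * conjc z = ((cabs z) ^+ 2)%:C.
Proof.
case: z => x y; rewrite /cabs /= sqr_sqrtr ?addr_ge0 ?sqr_ge0 //.
by apply/eqP; rewrite eq_complex /=; apply/andP; split; apply/eqP; ring.
Qed.

Definition cmeas g : Prop := measR (fun p => complex.Re (g p)) /\ measR (fun p => complex.Im (g p)).

Lemma cmeas_cst (c : R[i]) : cmeas (fun _ => c).
Proof. by split; exact: measR_cst. Qed.

Lemma cmeasD g h : cmeas g -> cmeas h -> cmeas (fun p => g p + h p).
Proof.
move=> [g1 g2] [h1 h2]; split.
  rewrite (_ : (fun p => _) = fun p => complex.Re (g p) + complex.Re (h p)); first exact: measR_add.
  by apply/funext => p; case: (g p); case: (h p).
rewrite (_ : (fun p => _) = fun p => complex.Im (g p) + complex.Im (h p)); first exact: measR_add.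
by apply/funext => p; case: (g p); case: (h p).
Qed.

Lemma cmeasM g h : cmeas g -> cmeas h -> cmeas (fun p => g p * h p).
Proof.
move=> [g1 g2] [h1 h2]; split.
  rewrite (_ : (fun p => _) = fun p => complex.Re (g p) * complex.Re (h p)
    - complex.Im (g p) * complex.Im (h p)).
    by apply: measR_sub; exact: measR_mul.
  by apply/funext => p; case: (g p); case: (h p).
rewrite (_ : (fun p => _) = fun p => complex.Re (g p) * complex.Im (h p)
  + complex.Im (g p) * complex.Re (h p)).
  by apply: measR_add; exact: measR_mul.
by apply/funext => p; case: (g p); case: (h p).
Qed.

Lemma cmeasX g n : cmeas g -> cmeas (fun p => g p ^+ n).
Proof.
move=> hg; elim: n => [|n IH]; first by under eq_fun do rewrite expr0; exact: cmeas_cst.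
by under eq_fun do rewrite exprS; exact: cmeasM.
Qed.

Lemma cmeas_sum (I : Type) (s : seq I) (P : pred I) (F : I -> 'rV[R]_N -> R[i]) :
  (forall i, cmeas (F i)) -> cmeas (fun p => \sum_(i <- s | P i) F i p).
Proof.
move=> hF; elim: s => [|i s IH].
  by under eq_fun do rewrite big_nil; exact: cmeas_cst.
under eq_fun do rewrite big_cons.
by case: (P i) => //; exact: cmeasD.
Qed.

Lemma cmeas_prod (I : Type) (s : seq I) (P : pred I) (F : I -> 'rV[R]_N -> R[i]) :
  (forall i, cmeas (F i)) -> cmeas (fun p => \prod_(i <- s | P i) F i p).
Proof.
move=> hF; elim: s => [|i s IH].
  by under eq_fun do rewrite big_nil; exact: cmeas_cst.
under eq_fun do rewrite big_cons.
by case: (P i) => //; exact: cmeasM.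
Qed.

Lemma measR_cabs g : cmeas g -> measR (fun p => cabs (g p)).
Proof.
move=> [g1 g2].
rewrite (_ : (fun p => _) = fun p =>
  Num.sqrt (complex.Re (g p) ^+ 2 + complex.Im (g p) ^+ 2)); last first.
  by apply/funext => p; case: (g p).
apply: (measR_fun1 (g := Num.sqrt)).
  by apply: continuous_measurable_fun; exact: sqrt_continuous.
by apply: measR_add; exact: measR_sqr.
Qed.
End LinePolyClosure.

(** * Hyperplane arrangements *)

Section Arrangement.
Context (R : realType) (m d : nat) (a : 'I_d -> 'I_m -> R[i]) (b : 'I_d -> R[i]).
Local Notation L i p := (affL a b i (cpt p)).

Lemma linepoly_cpt (j : 'I_m) : linepoly 1 (fun p : 'rV[R]_(m + m) => cpt p j).
Proof.
move=> p q; exists (cpt q j *: 'X + (cpt p j)%:P) => [|t].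
  apply: leq_trans (size_polyD _ _) _; rewrite geq_max.
  rewrite (leq_trans (size_scale_leq _ _)) ?size_polyX //.
  by rewrite (leq_trans (size_polyC_leq1 _)).
rewrite hornerD hornerZ hornerX hornerC /cpt !mxE.
by apply/eqP; rewrite eq_complex /=; apply/andP; split; apply/eqP; ring.
Qed.

Lemma linepoly_affL (i : 'I_d) : linepoly 1 (fun p : 'rV[R]_(m + m) => L i p).
Proof.
apply: linepolyD; last exact: linepoly_cst.
apply: linepoly_sum => j.
by apply: (@linepolyM _ _ 0 1 (fun=> a i j)); [exact: linepoly_cst|exact: linepoly_cpt].
Qed.

Lemma cmeas_affL (i : 'I_d) : cmeas (fun p : 'rV[R]_(m + m) => L i p).
Proof.
apply: cmeasD; last exact: cmeas_cst.
apply: cmeas_sum => j; apply: cmeasM; first exact: cmeas_cst.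
by split; exact: measR_coord.
Qed.

Lemma cpt_surj (z : 'I_m -> R[i]) : exists p : 'rV[R]_(m + m), cpt p = z.
Proof.
exists (row_mx (\row_j complex.Re (z j)) (\row_j complex.Im (z j))).
apply/funext => j; rewrite /cpt row_mxEl row_mxEr !mxE.
by case: (z j).
Qed.

(** Points supported on at most two axes provide all the explicit witnesses below; k = l is allowed,
    and with y = 0 it gives a point on a single axis. *)
Lemma affL_two_coords (i : 'I_d) (k l : 'I_m) (x y : R[i]) :
  affL a b i (fun j => x * (j == k)%:R + y * (j == l)%:R) = a i k * x + a i l * y + b i.
Proof.
rewrite /affL; congr (_ + _).
under eq_bigr do rewrite mulrDr.
rewrite big_split /=; congr (_ + _).
  rewrite (bigD1 k) //= eqxx mulr1 big1 ?addr0 // => j /negbTE ->.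
  by rewrite mulr0 mulr0.
rewrite (bigD1 l) //= eqxx mulr1 big1 ?addr0 // => j /negbTE ->.
by rewrite mulr0 mulr0.
Qed.

Context (hm : (1 <= m)%N).
Context (gen : generic_arrangement a b).

Lemma affL_coef_neq0 (i : 'I_d) : exists k, a i k != 0.
Proof.
apply: contrapT => /forallNP h.
have [+ _] := gen [set i]%SET; rewrite cards1 => /(_ hm (fun=> 1)) h1.
suff : (1 : R[i]) = 0 by move/eqP; rewrite oner_eq0.
apply: (h1 _ i); last by rewrite inE.
by move=> j; rewrite big_set1 mul1r; apply/eqP/negPn/negP; exact: h.
Qed.

Lemma affL_neq0 (i : 'I_d) : exists p : 'rV[R]_(m + m), L i p != 0.
Proof.
have [k ak] := affL_coef_neq0 i.
(* [L i] takes the value 1 at this point of the k-th axis. *)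
have [p hp] := cpt_surj (fun j => ((1 - b i) / a i k) * (j == k)%:R + 0 * (j == k)%:R).
exists p; rewrite hp affL_two_coords mulr0 addr0 mulrC divfK // subrK.
exact: oner_neq0.
Qed.

(* Otherwise the zero of [L i] would also be a zero of [L j], and moving inside
   the hyperplane [L i = 0] would show that the two gradients are proportional. *)
Lemma affL_abs_neq (i j : 'I_d) : i != j ->
  exists p : 'rV[R]_(m + m), cabs (L i p) != cabs (L j p).
Proof.
move=> ij; apply: contrapT => /forallNP h.
have h0 z : affL a b i z = 0 -> affL a b j z = 0.
  have [p <-] := cpt_surj z => Li.
  have := h p; rewrite Li cabs0 => /negP/negPn; rewrite eq_sym cabs_eq0.
  by move/eqP.
have [k ak] := affL_coef_neq0 i.
pose z0 (l : 'I_m) : R[i] := (- b i / a i k) * (l == k)%:R + 0 * (l == k)%:R.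
have Li0 : affL a b i z0 = 0.
  by rewrite affL_two_coords mulr0 addr0 mulrC divfK // addNr.
have Lj0 := h0 _ Li0.
have [h1 h2] := gen [set i; j]%SET.
have cS : #|[set i; j]%SET| = 2%N by rewrite cards2 ij.
(* For m = 1 two members already exceed the dimension, so genericity forbids the common zero [z0];
   for m >= 2 it makes the two gradients independent. *)
have [m2|m2] := leqP 2 m; last first.
  apply: h2; rewrite ?cS //; exists z0 => t.
  by rewrite !inE => /orP[] /eqP ->.
have prop l : a i k * a j l = a i l * a j k.
  (* [z1] - [z0] is a_ik e_l - a_il e_k, which lies in the kernel of the linear part of [L i]. *)
  pose z1 (t : 'I_m) : R[i] := (- b i / a i k - a i l) * (t == k)%:R + a i k * (t == l)%:R.
  have Li1 : affL a b i z1 = 0.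
    rewrite affL_two_coords mulrBr [a i k * (_ / _)]mulrC divfK // [a i l * _]mulrC.
    by rewrite subrK addNr.
  have := h0 _ Li1; move: Lj0; rewrite !affL_two_coords mulr0 addr0 mulrBr => E1 E2.
  apply/eqP; rewrite -subr_eq0 -E2 -[X in _ == X]subr0 -[X in _ == _ - X]E1.
  by apply/eqP; ring.
(* By [prop], the coefficients -a_jk and a_ik give a linear relation between the gradients of [L i]
   and [L j]; independence forces a_ik = 0. *)
have := h1; rewrite cS => /(_ m2 (fun t => if t == i then - a j k else a i k)) h3.
suff /eqP : a i k = 0 by rewrite (negbTE ak).
have := h3 _ j; rewrite eq_sym (negbTE ij); apply; last by rewrite !inE eqxx orbT.
move=> l; rewrite big_setU1 ?inE //= big_set1 eqxx eq_sym (negbTE ij) prop.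
by rewrite mulNr mulrC addNr.
Qed.

(** Pairwise distinct moduli are more than a unique minimum, but they form a finite conjunction of
    polynomial inequations, which [aeN_forall] and [linepoly_ae_neq0] can treat. *)
Definition good (p : 'rV[R]_(m + m)) : Prop :=
  (forall i, L i p != 0) /\ (forall ij : 'I_d * 'I_d, ij.1 != ij.2 ->
    cabs (L ij.1 p) != cabs (L ij.2 p)).

Lemma aeN_good : aeN good.
Proof.
apply: aeN_and.
  apply: aeN_forall => i; have [p0 hp0] := affL_neq0 i.
  exact: (linepoly_ae_neq0 (linepoly_affL i) hp0).
apply: aeN_forall => -[i j] /=.
have [->|ij] := eqVneq i j; first by apply: aeN_all => p; rewrite eqxx.
(* This is |L_i|^2 - |L_j|^2: squaring turns the comparison of moduli into a polynomial of degree at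
   most 2 along lines. *)
pose g p := L i p * conjc (L i p) + (-1) * (L j p * conjc (L j p)).
have lg : linepoly 2 g.
  have lc t := linepolyM (linepoly_affL t) (linepoly_conj (linepoly_affL t)).
  apply: linepolyD => //.
  by apply: (@linepolyM _ _ 0 2 (fun=> -1)); [exact: linepoly_cst|exact: lc].
have gE p : g p = ((cabs (L i p)) ^+ 2 - (cabs (L j p)) ^+ 2)%:C.
  by rewrite /g !mul_conjc mulN1r rmorphB.
have [p0 hp0] := affL_abs_neq ij.
have gp0 : g p0 != 0.
  rewrite gE -[0]/(0%:C) (inj_eq (@complexI R)) subr_eq0.
  by rewrite eqrXn2 // cabs_ge0.
apply: aeN_imply (linepoly_ae_neq0 lg gp0) => p hp _.
by apply: contra hp => /eqP e; rewrite gE e subrr.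
Qed.

Context (hd : (1 <= d)%N).

Lemma Psi_eq (F : 'I_d -> R) (i0 : 'I_d) : (forall i, F i <= F i0) ->
  fine (\big[Order.max/-oo%E]_(i < d) (F i)%:E) = F i0.
Proof.
move=> h; rewrite (_ : \big[_/_]_(i < d) _ = (F i0)%:E) //.
apply/eqP; rewrite eq_le; apply/andP; split.
  by apply: bigmax_le; [rewrite leNye|move=> i _; rewrite lee_fin].
exact: (le_bigmax _ (fun i => (F i)%:E) i0).
Qed.

(** This is |P| / |L_i|, written without division; its n-th power is the modulus of the i-th summand
    of [Qpoly]. *)
Definition coprod (p : 'rV[R]_(m + m)) (i : 'I_d) : R := \prod_(j < d | j != i) cabs (L j p).

Lemma coprod_gt0 p i : good p -> 0 < coprod p i.
Proof. by move=> [h _]; apply: prodr_gt0 => j _; rewrite cabs_gt0. Qed.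

Lemma coprod_mul p i : coprod p i * cabs (L i p) = \prod_(j < d) cabs (L j p).
Proof. by rewrite [RHS](bigD1 i) //= mulrC. Qed.

(** Since [coprod p i] times |L_i| is the same for all i, maximizing the first is minimizing the
    second, and a tie would force two equal moduli. *)
Lemma good_min p : good p -> exists i0 : 'I_d, (forall i, coprod p i <= coprod p i0) /\
  (forall i, i != i0 -> coprod p i < coprod p i0).
Proof.
move=> gp; have [h0 h1] := gp.
pose c i := cabs (L i p).
have c0 i : 0 < c i by rewrite /c cabs_gt0.
case: (@Order.TotalTheory.arg_minP _ _ _ (Ordinal hd) xpredT c isT) => i0 _ imin.
have le i : coprod p i <= coprod p i0.
  rewrite -(ler_pM2r (c0 i0)) [leRHS]coprod_mul -(coprod_mul p i) ler_pM2l ?coprod_gt0 //.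
  exact: imin.
exists i0; split => // i ii0; rewrite lt_def le andbT.
apply/eqP => e; have := h1 (i, i0) ii0 => /= /eqP; apply.
have := coprod_mul p i; rewrite -(coprod_mul p i0) e => /mulfI; apply.
by rewrite gt_eqF // coprod_gt0.
Qed.

Lemma Psi_good p i0 : good p -> (forall i, coprod p i <= coprod p i0) ->
  Psi a b (cpt p) = ln (coprod p i0).
Proof.
move=> gp h; have [h0 _] := gp.
have E i : \sum_(j < d | j != i) ln (cabs (L j p)) = ln (coprod p i).
  by rewrite ln_prod // => j _; rewrite cabs_gt0.
rewrite /Psi (@Psi_eq _ i0) ?E // => i.
by rewrite !E ler_ln ?posrE ?coprod_gt0.
Qed.

Lemma cabs_Qterm p n i : cabs (\prod_(j < d | j != i) L j p ^+ n) = coprod p i ^+ n.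
Proof.
by rewrite cabs_prod /coprod -prodrXl; apply: eq_bigr => j _; rewrite cabsX.
Qed.

(* The term of the index minimizing [cabs (L i p)] dominates the sum [Qpoly]. *)
Lemma good_near p (e : R) : good p -> 0 < e -> \forall n \near \oo,
  Qpoly a b n (cpt p) != 0 /\
  `|Psi a b (cpt p) - (n%:R)^-1 * ln (cabs (Qpoly a b n (cpt p)))| <= e.
Proof.
move=> gp e0; have [i0 [le lt]] := good_min gp.
rewrite (Psi_good gp le); set A := coprod p i0.
have A0 : 0 < A by exact: coprod_gt0.
have d0 : 0 < d%:R :> R by rewrite ltr0n.
(* With this threshold the fewer than d other terms add up to at most half of the dominant one. *)
have small : \forall n \near \oo, forall i, i != i0 ->
    (coprod p i / A) ^+ n <= (d%:R)^-1 / 2.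
  apply: filter_forall => i.
  have [->|ii0] := eqVneq i i0; first by apply: nearW.
  have q1 : `|coprod p i / A| < 1.
    by rewrite ger0_norm ?divr_ge0 ?ltW ?coprod_gt0 // ltr_pdivrMr // mul1r lt.
  have d20 : 0 < (d%:R)^-1 / 2 :> R by rewrite divr_gt0 // invr_gt0.
  have /cvgrPdist_le/(_ _ d20) := cvg_expr q1.
  apply: filterS => n; rewrite sub0r normrN => h _.
  exact: le_trans (ler_norm _) h.
near=> n.
(* ln |Q_n| and n ln A will differ by at most ln 2 <= 1, which leaves an error of at most 1/n. *)
have nE : e^-1 <= n%:R by near: n; exact: nbhs_infty_ger.
have n0 : 0 < n%:R :> R by apply: lt_le_trans nE; rewrite invr_gt0.
have sm i : i != i0 -> (coprod p i / A) ^+ n <= (d%:R)^-1 / 2.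
  by move: i; near: n.
pose X := \prod_(j < d | j != i0) L j p ^+ n.
pose Y := \sum_(i < d | i != i0) \prod_(j < d | j != i) L j p ^+ n.
have QE : Qpoly a b n (cpt p) = X + Y by rewrite /Qpoly (bigD1 i0).
have cX : cabs X = A ^+ n by exact: cabs_Qterm.
have An : 0 < A ^+ n by rewrite exprn_gt0.
have cY : cabs Y <= A ^+ n / 2.
  apply: le_trans (cabs_sum_le _ _ _) _.
  apply: (@le_trans _ _ (\sum_(i < d | i != i0) (A ^+ n * ((d%:R)^-1 / 2)))).
    apply: ler_sum => i ii0; rewrite cabs_Qterm -ler_pdivrMl // mulrC -expr_div_n.
    exact: sm.
  apply: (@le_trans _ _ (\sum_(i < d) (A ^+ n * ((d%:R)^-1 / 2)))).
    rewrite [leRHS](bigID (fun i => i != i0)) /= lerDl sumr_ge0 // => i _.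
    by rewrite !mulr_ge0 ?invr_ge0 // ltW.
  rewrite sumr_const card_ord -[_ *+ d]mulr_natr le_eqVlt; apply/orP; left; apply/eqP.
  by field; rewrite gt_eqF.
have up : cabs (X + Y) <= A ^+ n * 2.
  by apply: le_trans (cabsD _ _) _; rewrite cX; lra.
have lo : A ^+ n / 2 <= cabs (X + Y).
  have := cabsD (X + Y) (- Y); rewrite addrK [cabs (- Y)]normcN cX -/(cabs Y); lra.
have Q0 : 0 < cabs (X + Y) by apply: lt_le_trans lo; rewrite divr_gt0.
have ln2 : ln (2 : R) <= 1.
  by have := @le_ln1Dx R 1; apply; lra.
have lup : ln (cabs (X + Y)) <= ln A * n%:R + 1.
  apply: (@le_trans _ _ (ln (A ^+ n * 2))); first by rewrite ler_ln ?posrE ?mulr_gt0.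
  by rewrite lnM ?posrE // lnXn // -[ln A *+ n]mulr_natr lerD2l.
have llo : ln A * n%:R - 1 <= ln (cabs (X + Y)).
  apply: (@le_trans _ _ (ln (A ^+ n / 2))); last by rewrite ler_ln ?posrE ?divr_gt0.
  rewrite lnM ?posrE ?invr_gt0 // lnV ?posrE // lnXn // -[ln A *+ n]mulr_natr; lra.
rewrite QE; split; first by rewrite -cabs_gt0.
set q := ln (cabs (X + Y)).
have -> : ln A - n%:R^-1 * q = (ln A * n%:R - q) / n%:R by field; rewrite gt_eqF.
rewrite normrM normfV [`|n%:R|]ger0_norm // ler_pdivrMr //.
apply: (@le_trans _ _ 1); last by rewrite -ler_pdivrMl // mulr1.
by rewrite ler_norml; apply/andP; split; rewrite /q; lra.
Unshelve. all: by end_near. Qed.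

Lemma good_cvg p : good p ->
  (n%:R)^-1 * ln (cabs (Qpoly a b n (cpt p))) @[n --> \oo] --> Psi a b (cpt p).
Proof.
move=> gp; apply/cvgrPdist_le => e e0.
by apply: filterS (good_near gp e0) => n [].
Qed.
End Arrangement.

(** * Bounds for the potentials on a cube *)

Section Bounds.
Context (R : realType) (m d : nat) (a : 'I_d -> 'I_m -> R[i]) (b : 'I_d -> R[i]).
Context (hm : (1 <= m)%N).
Context (hd : (1 <= d)%N).
Context (gen : generic_arrangement a b).
Local Notation L i p := (affL a b i (cpt p)).

Definition logQ (n : nat) (p : 'rV[R]_(m + m)) : R :=
  (n%:R)^-1 * ln (cabs (Qpoly a b n (cpt p))).

Definition prodL (p : 'rV[R]_(m + m)) : R[i] := \prod_(j < d) L j p.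

Lemma cabs_le_norm1 (x y : R) : cabs (x +i* y) <= `|x| + `|y|.
Proof.
have xy0 : 0 <= `|x| + `|y| by rewrite addr_ge0.
rewrite /cabs /= -[leRHS](ger0_norm xy0) -sqrtr_sqr ler_sqrt ?sqr_ge0 //.
rewrite sqrrD !real_normK ?num_real //.
by have := mulr_ge0 (normr_ge0 x) (normr_ge0 y); lra.
Qed.

Lemma affL_bound (M : R) : 0 <= M ->
  exists2 K : R, 1 <= K & forall i p, `|p| <= M -> cabs (L i p) <= K.
Proof.
move=> M0; pose B i := \sum_(j < m) cabs (a i j) * (M + M) + cabs (b i).
have B0 i : 0 <= B i.
  by rewrite addr_ge0 ?cabs_ge0 // sumr_ge0 // => j _; rewrite mulr_ge0 ?cabs_ge0 ?addr_ge0.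
exists (1 + \sum_(i < d) B i); first by rewrite lerDl sumr_ge0.
move=> i p /(normrv_le _ M0) pM.
apply: (@le_trans _ _ (B i)); last first.
  by rewrite (bigD1 i) //= addrCA lerDl addr_ge0 // sumr_ge0.
apply: le_trans (cabsD _ _) _; rewrite lerD2r.
apply: le_trans (cabs_sum_le _ _ _) _; apply: ler_sum => j _.
rewrite cabsM; apply: ler_wpM2l; first exact: cabs_ge0.
by apply: le_trans (cabs_le_norm1 _ _) _; exact: lerD.
Qed.

Lemma coprod_bound (K : R) p i : 1 <= K -> (forall i, cabs (L i p) <= K) ->
  coprod a b p i <= K ^+ d.
Proof.
move=> K1 hK; have K0 : 0 <= K by lra.
apply: (@le_trans _ _ (\prod_(j < d | j != i) K)).
  by apply: ler_prod => j _; rewrite cabs_ge0 hK.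
rewrite -[in leRHS](card_ord d) -prodr_const [leRHS](bigD1 i) //=.
by rewrite ler_peMl // prodr_ge0.
Qed.

(** There are d summands, each at most K^(dn); after division by n the factor d costs at most ln
    d. *)
Lemma logQ_ub (K : R) n p : 1 <= K -> (0 < n)%N -> (forall i, cabs (L i p) <= K) ->
  logQ n p <= ln d%:R + d%:R * ln K.
Proof.
move=> K1 n0 hK; rewrite /logQ; set Q := cabs _.
have K0 : 0 < K by lra.
have lK : 0 <= ln K by rewrite ln_ge0.
have ld : 0 <= ln d%:R :> R by rewrite ln_ge0 // ler1n.
have n0' : 0 < n%:R :> R by rewrite ltr0n.
have d0 : 0 < d%:R :> R by rewrite ltr0n.
have U0 : 0 <= ln d%:R + d%:R * ln K by rewrite addr_ge0 // mulr_ge0.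
(* [ln] is 0 at nonpositive arguments; K >= 1 makes the bound nonnegative there. *)
have [Q0|Q0] := leP Q 0; first by rewrite ln0 // mulr0.
rewrite mulrC ler_pdivrMr //.
have QK : Q <= d%:R * K ^+ (d * n).
  apply: le_trans (cabs_sum_le _ _ _) _.
  apply: (@le_trans _ _ (\sum_(i < d) K ^+ (d * n))).
    apply: ler_sum => i _; rewrite cabs_Qterm exprM; apply: lerXn2r; rewrite ?nnegrE.
    - by apply: prodr_ge0 => j _; exact: cabs_ge0.
    - by rewrite exprn_ge0 // ltW.
    - exact: coprod_bound.
  by rewrite sumr_const card_ord -[_ *+ d]mulr_natl.
apply: (@le_trans _ _ (ln (d%:R * K ^+ (d * n)))).
  by rewrite ler_ln ?posrE // mulr_gt0 // exprn_gt0.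
rewrite lnM ?posrE ?exprn_gt0 // lnXn // -[_ *+ (d * n)]mulr_natl natrM mulrDl lerD //.
  by rewrite ler_peMr // ler1n.
by rewrite mulrAC.
Qed.

(** From above by [logQ_ub]; from below by the value at p0, which is within 1 of Psi for n large,
    minus the drop. Nonvanishing at p0 is recorded because [boxint_logdrop] asks for it. *)
Lemma logQ_bound (M : R) (p0 : 'rV[R]_(m + m)) : 0 <= M -> good a b p0 -> `|p0| <= M ->
  exists2 C : R, 0 <= C & \forall n \near \oo, [/\ (0 < n)%N, Qpoly a b n (cpt p0) != 0 &
    forall p, `|p| <= M -> `|logQ n p| <= C + (n%:R)^-1 *
      logdrop (cabs (Qpoly a b n (cpt p0))) (cabs (Qpoly a b n (cpt p)))].
Proof.
move=> M0 gp0 p0M; have [K K1 hK] := affL_bound M0.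
have lK : 0 <= ln K by rewrite ln_ge0.
have ld : 0 <= ln d%:R :> R by rewrite ln_ge0 // ler1n.
have U0 : 0 <= ln d%:R + d%:R * ln K by rewrite addr_ge0 // mulr_ge0.
exists (ln d%:R + d%:R * ln K + `|Psi a b (cpt p0)| + 1).
  by rewrite addr_ge0 // addr_ge0.
near=> n.
have n0 : (0 < n)%N by near: n; exact: nbhs_infty_gt.
have [Q0 hQ] : Qpoly a b n (cpt p0) != 0 /\
    `|Psi a b (cpt p0) - (n%:R)^-1 * ln (cabs (Qpoly a b n (cpt p0)))| <= 1.
  by near: n; apply: good_near.
split => // p pM.
have ub := logQ_ub K1 n0 (fun i => hK i p pM).
have n0' : 0 <= (n%:R)^-1 :> R by [].
set D := logdrop _ _.
have D0 : 0 <= D by exact: logdrop_ge0.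
have hD : ln (cabs (Qpoly a b n (cpt p0))) - ln (cabs (Qpoly a b n (cpt p))) <= D.
  by rewrite /D /logdrop le_max lexx orbT.
have nD : 0 <= (n%:R)^-1 * D by rewrite mulr_ge0.
have := ler_wpM2l n0' hD; rewrite mulrBr -/(logQ n p) -/(logQ n p0) => hD'.
move: hQ; rewrite -/(logQ n p0) ler_norml => /andP[h1 h2].
have := ler_norm (- Psi a b (cpt p0)); rewrite normrN => h3.
have h4 := normr_ge0 (Psi a b (cpt p0)).
by rewrite ler_norml; apply/andP; split; lra.
Unshelve. all: by end_near. Qed.

(** At a good point Psi is log |P| - log |L_i0| with |L_i0| <= K, so it is bounded below through the
    fixed polynomial P, and above by d ln K. *)
Lemma Psi_bound (M : R) (p0 : 'rV[R]_(m + m)) : 0 <= M ->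
  exists2 C : R, 0 <= C & forall p, `|p| <= M -> good a b p ->
    `|Psi a b (cpt p)| <= C + logdrop (cabs (prodL p0)) (cabs (prodL p)).
Proof.
move=> M0; have [K K1 hK] := affL_bound M0.
have K0 : 0 < K by lra.
have lK : 0 <= ln K by rewrite ln_ge0.
exists (d%:R * ln K + ln K + `|ln (cabs (prodL p0))|); first by rewrite !addr_ge0 // mulr_ge0.
move=> p pM gp; have [i0 [le _]] := good_min hd gp.
have c0 := coprod_gt0 i0 gp; have [L0 _] := gp.
rewrite (Psi_good gp le).
have up : ln (coprod a b p i0) <= d%:R * ln K.
  apply: (@le_trans _ _ (ln (K ^+ d))); last by rewrite lnXn // mulr_natl.
  rewrite ler_ln ?posrE ?exprn_gt0 //; apply: coprod_bound => // i; exact: hK.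
have lL : ln (cabs (L i0 p)) <= ln K by rewrite ler_ln ?posrE ?cabs_gt0 //; exact: hK.
have E : ln (cabs (prodL p)) = ln (coprod a b p i0) + ln (cabs (L i0 p)).
  by rewrite /prodL cabs_prod -(coprod_mul a b p i0) lnM ?posrE ?cabs_gt0.
set D := logdrop _ _.
have D0 : 0 <= D by exact: logdrop_ge0.
have hD : ln (cabs (prodL p0)) - ln (cabs (prodL p)) <= D.
  by rewrite /D /logdrop le_max lexx orbT.
have := ler_norm (- ln (cabs (prodL p0))); rewrite normrN => h3.
have h4 := normr_ge0 (ln (cabs (prodL p0))).
have h5 : 0 <= d%:R * ln K by rewrite mulr_ge0.
by rewrite ler_norml; apply/andP; split; lra.
Qed.

Lemma size_index_ord : size (index_enum 'I_d) = d.
Proof. by rewrite [index_enum _]unlock -enumT size_enum_ord. Qed.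

Lemma linepoly_Qpoly n : linepoly (d * (n * 1)) (fun p : 'rV[R]_(m + m) => Qpoly a b n (cpt p)).
Proof.
apply: linepoly_sum => i; rewrite -[X in linepoly (X * _)]size_index_ord.
by apply: linepoly_prod => j; apply: linepolyX; exact: linepoly_affL.
Qed.

Lemma linepoly_prodL : linepoly (d * 1) prodL.
Proof.
rewrite -[X in linepoly (X * _)]size_index_ord.
by apply: linepoly_prod => j; exact: linepoly_affL.
Qed.

Lemma measR_cabs_Qpoly n : measR (fun p : 'rV[R]_(m + m) => cabs (Qpoly a b n (cpt p))).
Proof.
apply: measR_cabs; apply: cmeas_sum => i; apply: cmeas_prod => j; apply: cmeasX.
exact: cmeas_affL.
Qed.

Lemma measR_cabs_prodL : measR (fun p => cabs (prodL p)).
Proof. by apply: measR_cabs; apply: cmeas_prod => j; exact: cmeas_affL. Qed.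

Lemma measR_logQ n : measR (logQ n).
Proof.
apply: measR_mul; first exact: measR_cst.
by apply: (measR_fun1 (g := @ln R)); [exact: measurable_ln|exact: measR_cabs_Qpoly].
Qed.

Lemma measR_Psi : measR (fun p : 'rV[R]_(m + m) => Psi a b (cpt p)).
Proof.
pose F i (p : 'rV[R]_(m + m)) : R := \sum_(j < d | j != i) ln (cabs (L j p)).
have mF i : measR (F i).
  rewrite /F; elim: (index_enum _) => [|j s IH].
    by under eq_fun do rewrite big_nil; exact: measR_cst.
  under eq_fun do rewrite big_cons.
  case: (j != i) => //; apply: measR_add => //.
  apply: (measR_fun1 (g := @ln R)); first exact: measurable_ln.
  by apply: measR_cabs; exact: cmeas_affL.
apply: (@measR_comp _ _ _ (\bar R) _ R fine) => //.
change (measR (fun p => \big[Order.max/-oo%E]_(i < d) (F i p)%:E)).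
elim: (index_enum _) => [|j s IH].
  by under eq_fun do rewrite big_nil; exact: measR_cst.
under eq_fun do rewrite big_cons.
apply: (@measR_comp2 _ _ _ (\bar R) _ (\bar R) _ (\bar R) Order.max _ _ _ _ IH).
  by apply: measurable_maxe; [exact: measurable_fst|exact: measurable_snd].
exact: measR_EFin.
Qed.
End Bounds.

Section SquareBound.
Context (R : realType) (M : R) (M0 : 0 <= M) (N : nat).

(** Rests on (x + y + z)^2 <= 3 (x^2 + y^2 + z^2). Two functions are allowed because u_n - Psi is
    controlled by the drops of Q_n and of P together. *)
Lemma boxint_sqr_le (f h1 h2 : 'rV[R]_N -> R) (C K1 K2 : R) :
  measR f -> measR h1 -> measR h2 -> 0 <= C ->
  (forall p, 0 <= h1 p) -> (forall p, 0 <= h2 p) ->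
  aeN (fun p => `|p| <= M -> `|f p| <= C + h1 p + h2 p) ->
  (boxint M (fun p => (h1 p ^+ 2)%:E) <= K1%:E)%E ->
  (boxint M (fun p => (h2 p ^+ 2)%:E) <= K2%:E)%E ->
  (boxint M (fun p => (f p ^+ 2)%:E) <= (3 * (C ^+ 2 * (M + M) ^+ N + K1 + K2))%:E)%E.
Proof.
move=> mf mh1 mh2 C0 h10 h20 hae hK1 hK2.
have sq (y : R) : (0 <= (y ^+ 2)%:E)%E by rewrite lee_fin sqr_ge0.
have m1 := measR_EFin (measR_sqr mh1).
have m2 := measR_EFin (measR_sqr mh2).
have mc : measR (fun _ : 'rV[R]_N => (C ^+ 2)%:E) by exact: measR_cst.
have mc1 : measR (fun p => (C ^+ 2)%:E + (h1 p ^+ 2)%:E)%E.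
  by apply: measR_EFin; apply: measR_add; [exact: measR_cst|exact: measR_sqr].
have ms : measR (fun p => (C ^+ 2)%:E + (h1 p ^+ 2)%:E + (h2 p ^+ 2)%:E)%E.
  apply: measR_EFin; apply: measR_add; last exact: measR_sqr.
  by apply: measR_add; [exact: measR_cst|exact: measR_sqr].
have c10 p : (0 <= (C ^+ 2)%:E + (h1 p ^+ 2)%:E)%E by rewrite adde_ge0.
have s0 p : (0 <= (C ^+ 2)%:E + (h1 p ^+ 2)%:E + (h2 p ^+ 2)%:E)%E by rewrite adde_ge0.
apply: (@le_trans _ _ (boxint M (fun p =>
  3%:E * ((C ^+ 2)%:E + (h1 p ^+ 2)%:E + (h2 p ^+ 2)%:E))%E)).
  apply: le_boxint_ae => //.
  - by move=> p; rewrite mule_ge0 // lee_fin.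
  - exact: measR_EFin (measR_sqr mf).
  - apply: measR_EFin; apply: measR_mul; first exact: measR_cst.
    apply: measR_add; last exact: measR_sqr.
    by apply: measR_add; [exact: measR_cst|exact: measR_sqr].
  apply: aeN_imply hae => p hp /hp {}hp.
  rewrite -!EFinD -EFinM lee_fin -real_normK ?num_real //.
  apply: (@le_trans _ _ ((C + h1 p + h2 p) ^+ 2)); first by rewrite lerXn2r // nnegrE !addr_ge0.
  move: (C) (h1 p) (h2 p) => x y z.
  by have := sqr_ge0 (x - y); have := sqr_ge0 (x - z); have := sqr_ge0 (y - z); rewrite !expr2; nra.
rewrite boxintZ // boxintD // boxintD // boxint_cst // [leRHS]EFinM !EFinD.
by apply: lee_wpmul2l; [rewrite lee_fin|apply: leeD => //; exact: leeD].
Qed.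
End SquareBound.

(** * Passage to the limit *)

Section Convergence.
Context (R : realType) (m d : nat) (a : 'I_d -> 'I_m -> R[i]) (b : 'I_d -> R[i]).
Context (hm : (1 <= m)%N).
Context (hd : (1 <= d)%N).
Context (gen : generic_arrangement a b).

(** Asking of phi only continuity and bounded support lets one statement serve the real and
    imaginary parts of all second derivatives. *)
Lemma cvg_iint_logQ (phi : 'rV[R]_(m + m) -> R) (M : R) :
  continuous phi -> (forall p, M < `|p| -> phi p = 0) ->
  iint (fun p => logQ a b n p * phi p) @[n --> \oo]
    --> iint (fun p => Psi a b (cpt p) * phi p).
Proof.
move=> cphi sphi.
have [B B0 hB] := continuous_supp_bounded cphi sphi.
have [p0 gp0] := aeN_ex (aeN_good hm gen).
(* Large enough for the support of phi and for the base point. *)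
pose M1 : R := `|M| + `|p0|.
have M10 : 0 <= M1 by rewrite addr_ge0.
have p0M : `|p0| <= M1 by rewrite lerDr.
have sphi1 p : M1 < `|p| -> phi p = 0.
  move=> h; apply: sphi; apply: le_lt_trans h; apply: le_trans (ler_norm M) _.
  by rewrite lerDl.
have [K K0 hK] := boxint_logdrop (m + m) M10.
have [C1 C10 nearQ] := logQ_bound hd M10 gp0 p0M.
have [C2 C20 boundP] := Psi_bound a b hd p0 M10.
have P0 : prodL a b p0 != 0.
  by rewrite /prodL prodf_seq_neq0; apply/allP => j _ /=; have [h _] := gp0; exact: h.
have KP := hK _ _ p0 (linepoly_prodL a b) (measR_cabs_prodL a b) p0M P0.
pose lpP p := logdrop (cabs (prodL a b p0)) (cabs (prodL a b p)).
have mlp (f : 'rV[R]_(m + m) -> R) c : measR f -> measR (fun p => logdrop c (f p)).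
  by move=> mf; apply: (measR_fun1 (g := logdrop c)) => //; exact: measurable_logdrop.
have mlpP : measR lpP by apply: mlp; exact: measR_cabs_prodL.
have lpP0 p : 0 <= lpP p by exact: logdrop_ge0.
have z0 : (boxint M1 (fun _ : 'rV[R]_(m + m) => ((0 : R) ^+ 2)%:E) <= 0%:E)%E.
  by rewrite expr0n /= boxint_cst // mul0r.
have mPsi := measR_Psi a b.
have L2Psi : (boxint M1 (fun p => (Psi a b (cpt p) ^+ 2)%:E) <=
    (3 * (C2 ^+ 2 * (M1 + M1) ^+ (m + m) + K * (d * 1)%:R ^+ 2 + 0))%:E)%E.
  have mz : measR (fun _ : 'rV[R]_(m + m) => 0 : R) by exact: measR_cst.
  (* Psi involves only the drop of P, so the second slot is filled with 0. *)
  apply: (boxint_sqr_le M10 mPsi mlpP mz C20 lpP0 (fun=> lexx 0) _ KP z0).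
  apply: aeN_imply (aeN_good hm gen) => p gp pM; rewrite addr0; exact: boundP.
apply: (cvg_iint_mul M10 _ mPsi (measR_continuous cphi) B0 hB sphi1 _ L2Psi).
- by move=> n; exact: measR_logQ.
- by apply: aeN_imply (aeN_good hm gen) => p; exact: good_cvg.
- apply: filterS nearQ => n [n0 Qn0 hQ].
  have n0' : 0 < n%:R :> R by rewrite ltr0n.
  pose lpn p := (n%:R)^-1 * logdrop (cabs (Qpoly a b n (cpt p0))) (cabs (Qpoly a b n (cpt p))).
  have mlog := mlp _ (cabs (Qpoly a b n (cpt p0))) (measR_cabs_Qpoly a b n).
  have mlpn : measR lpn by apply: measR_mul => //; exact: measR_cst.
  have lpn0 p : 0 <= lpn p by rewrite mulr_ge0 // logdrop_ge0.
  (* The degree of [Qpoly] along lines is at most d n, and n^2 cancels. *)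
  have Kn : (boxint M1 (fun p => (lpn p ^+ 2)%:E) <= (K * d%:R ^+ 2)%:E)%E.
    have h := hK _ _ p0 (linepoly_Qpoly a b n) (measR_cabs_Qpoly a b n) p0M Qn0.
    rewrite (eq_boxint M1 (g := fun p => ((n%:R)^-1 ^+ 2)%:E *
      (logdrop (cabs (Qpoly a b n (cpt p0))) (cabs (Qpoly a b n (cpt p))) ^+ 2)%:E)%E); last first.
      by move=> p; rewrite /lpn exprMn EFinM.
    rewrite boxintZ; [|exact: sqr_ge0|by move=> p; rewrite lee_fin sqr_ge0
      |exact: measR_EFin (measR_sqr mlog)].
    apply: le_trans (lee_wpmul2l _ h) _; first by rewrite lee_fin sqr_ge0.
    rewrite -EFinM lee_fin muln1 natrM le_eqVlt; apply/orP; left; apply/eqP.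
    by field; rewrite gt_eqF.
  apply: (boxint_sqr_le M10 _ mlpn mlpP (addr_ge0 C10 C20) lpn0 lpP0 _ Kn KP).
    by apply: measR_norm; apply: measR_sub => //; exact: measR_logQ.
  apply: aeN_imply (aeN_good hm gen) => p gp pM; rewrite normr_id.
  apply: le_trans (ler_normB _ _) _.
  have := hQ p pM; have := boundP p pM gp; rewrite -/(lpP p) -/(lpn p); lra.
Qed.
End Convergence.

Theorem theorem6p1 (R : realType) (m d : nat)
  (a : 'I_d -> 'I_m -> R[i]) (b : 'I_d -> R[i]) :
  (1 <= m)%N -> (1 <= d)%N ->
  (forall i : 'I_d, \sum_(j < m) `|a i j| ^+ 2 = 1) ->
  generic_arrangement a b ->
  ddc_cvg
    (fun (n : nat) (p : 'rV[R]_(m + m)) =>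
       (n%:R)^-1 * ln (cabs (Qpoly a b n (cpt p))))
    (fun p : 'rV[R]_(m + m) => Psi a b (cpt p)).
Proof.
move=> hm hd _ gen chi schi [M supp] j k.
have contD s t : continuous (rpartial s (rpartial t chi)).
  by have [] := schi [:: s; t].
have suppD s t p : M < `|p| -> rpartial s (rpartial t chi) p = 0.
  by apply: rpartial_supp => q; exact: rpartial_supp.
split; apply: (@cvg_iint_logQ R m d a b hm hd gen _ M).
- by move=> p; apply: continuousD; exact: contD.
- by move=> p pM; rewrite /ddc_re !suppD // addr0.
- by move=> p; apply: continuousB; exact: contD.
- by move=> p pM; rewrite /ddc_im !suppD // subr0.
Qed.
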